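(* Let \[ g(X) = X^{24} + \frac{3852443469645611961262219752967766016}{384257037754753807138505851908147025}\,(X^2 + 1) \] and \begin{align*} f(X) = X^{24} &- 24X^{22} + 8X^{21} + 252X^{20} - 168X^{19} - 1484X^{18} - 627X^{17}\\ &+26628X^{16} - 97918X^{15} + 199671X^{14} - 266679X^{13} + 234997X^{12}\\ &-114681X^{11} - 10107X^{10} + 63686X^9 - 45384X^8 + 6819X^7\\ &+ 12880X^6 - 12096X^5 + 5502X^4 - 1504X^3 + 252X^2 - 24X + 1, \end{align*} both regarded as polynomials in $\mathbb{Q}[X]$. Then the Galois group over $\mathbb{Q}$ of (the splitting field of) the product $f(X)g(X)$ is isomorphic to the Rubik's Cube group $\mathcal{R}$.
   Context: For $n\ge 2$, $\mathbb{Z}/(n)$ denotes the cyclic additive group of order $n$, and $\mathbb{S}_m$ denotes the symmetric group on $\{1,\dots,m\}$. For a finite group $A$ and a group $G$ acting on the right on a non-empty finite set $S$, let $A^S$ be the group of maps $S\to A$ with pointwise multiplication; $G$ acts on $A^S$ by $(x\cdot\alpha)(s)=\alpha(s\cdot x)$ for $x\in G$, $\alpha\in A^S$, $s\in S$. The wreath product $A\wr G$ is the semidirect product $A^S\rtimes G$ for this action, with product $(\alpha,x)(\beta,y)=(\alpha(x\cdot\beta),xy)$. For $\mathbb{Z}/(n)\wr\mathbb{S}_m$ one takes $S=\{1,\dots,m\}$ with the natural permutation action, and writes elements as $(x,\sigma)$ with $x=(x_1,\dots,x_m)\in(\mathbb{Z}/(n))^m$ and $\sigma\in\mathbb{S}_m$.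 The Rubik's Cube group $\mathcal{R}$ is the kernel of the group homomorphism \[ \Psi\colon \bigl(\mathbb{Z}/(3)\wr\mathbb{S}_8\bigr)\times\bigl(\mathbb{Z}/(2)\wr\mathbb{S}_{12}\bigr)\to \mathbb{Z}/(3)\times\mathbb{Z}/(2)\times\{\pm1\}, \] \[ (x,\rho,y,\sigma)\mapsto\Bigl(\sum_{i=1}^{8}x_i,\ \sum_{i=1}^{12}y_i,\ \operatorname{sign}(\rho)\operatorname{sign}(\sigma)\Bigr), \] where $x=(x_1,\dots,x_8)\in(\mathbb{Z}/(3))^8$, $\rho\in\mathbb{S}_8$, $y=(y_1,\dots,y_{12})\in(\mathbb{Z}/(2))^{12}$, $\sigma\in\mathbb{S}_{12}$. *)

(* Defs.v *)
From Stdlib Require Import BinNat.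
From HB Require Import structures.
From mathcomp Require Import all_boot all_order all_algebra.
From mathcomp Require Import all_fingroup all_solvable all_field.

Set Implicit Arguments.
Unset Strict Implicit.
Unset Printing Implicit Defensive.

Import GroupScope GRing.Theory.

(* A is written multiplicatively here; for A = 'Z_n the canonical finite group
   structure is the additive one. MathComp actions are right actions, so
   [wr_act to] is a left action of gT on the maps S -> A. *)
Definition wr_act (A gT : finGroupType) (S : finType)
    (to : {action gT &-> S}) (x : gT) (a : {ffun S -> A}) : {ffun S -> A} :=
  [ffun s => a (to s x)].

(* An alias of the product type, which already carries the direct product
   structure; the phantom parameter [to] lets the group law be inferred. *)
Definition wreath (A gT : finGroupType) (S : finType)
    (to : {action gT &-> S}) : Type := ({ffun S -> A} * gT)%type.

Section Wreath.

Variables (A gT : finGroupType) (S : finType) (to : {action gT &-> S}).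
Local Notation W := (wreath A to).

HB.instance Definition _ := Finite.on W.

Definition wr_one : W := ([ffun=> 1], 1).

Definition wr_mul (u v : W) : W :=
  ([ffun s => u.1 s * wr_act to u.2 v.1 s], u.2 * v.2).

Definition wr_inv (u : W) : W :=
  ([ffun s => (u.1 (to s u.2^-1))^-1], u.2^-1).

Lemma wr_mulA : associative wr_mul.
Proof.
move=> [a x] [b y] [c z]; congr (_, _) => /=; last exact: mulgA.
by apply/ffunP=> s; do !rewrite ffunE /=; rewrite mulgA actM.
Qed.

Lemma wr_mul1 : left_id wr_one wr_mul.
Proof.
move=> [a x]; congr (_, _) => /=; last exact: mul1g.
by apply/ffunP=> s; do !rewrite ffunE /=; rewrite mul1g act1.
Qed.

Lemma wr_mulV : left_inverse wr_one wr_inv wr_mul.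
Proof.
move=> [a x]; congr (_, _) => /=; last exact: mulVg.
by apply/ffunP=> s; do !rewrite ffunE /=; rewrite mulVg.
Qed.

HB.instance Definition _ := Finite_isGroup.Build W wr_mulA wr_mul1 wr_mulV.

End Wreath.

Definition cube_group : finGroupType :=
  (wreath ('Z_3) (perm_action 'I_8) * wreath ('Z_2) (perm_action 'I_12))%type.

(* {1, -1} is rendered as the group (bool, (+)), with b standing for (-1) ^+ b;
   [odd_perm] is the signature under this identification. *)
Definition cube_inv (w : cube_group) : 'Z_3 * 'Z_2 * bool :=
  let: ((x, rho), (y, sigma)) := w in
  ((\sum_i x i)%R, (\sum_i y i)%R, odd_perm rho (+) odd_perm sigma).

Lemma wr_sumM (n m : nat) (u v : wreath ('Z_n) (perm_action 'I_m)) :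
  (\sum_i (u * v)%g.1 i = \sum_i u.1 i + \sum_i v.1 i)%R.
Proof.
rewrite [in X in (_ + X)%R](reindex_inj (@perm_inj _ u.2)) -big_split /=.
by apply: eq_bigr => i _; rewrite !ffunE.
Qed.

Lemma cube_invM :
  {in [set: cube_group] &, {morph cube_inv : u v / u * v}}.
Proof.
move=> [[x r] [y s]] [[x' r'] [y' s']] _ _; congr (_, _, _) => /=.
- exact: (wr_sumM (x, r) (x', r')).
- exact: (wr_sumM (y, s) (y', s')).
by rewrite !odd_permM; case: (odd_perm r); case: (odd_perm r');
  case: (odd_perm s); case: (odd_perm s').
Qed.

Canonical cube_inv_morphism := Morphism cube_invM.

Definition rubik : {group cube_group} := 'ker cube_inv_morphism.

Lemma in_rubik x rho y sigma :
  (((x, rho), (y, sigma)) : cube_group) \in rubik =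
  [&& \sum_i x i == 0, \sum_i y i == 0
    & (-1) ^+ rho * (-1) ^+ sigma == 1 :> int]%R.
Proof.
have -> : ((-1) ^+ rho * (-1) ^+ sigma == 1 :> int)%R
    = (odd_perm rho (+) odd_perm sigma == false).
  by case: (odd_perm rho); case: (odd_perm sigma).
apply/(kerP cube_inv_morphism (in_setT _))/and3P.
  by case=> -> -> ->.
by case=> /eqP e1 /eqP e2 /eqP e3; congr (_, _, _).
Qed.

Local Open Scope ring_scope.

(* Decimal literals of ring_scope are unary naturals; coefficients are
   therefore entered as binary numerals. *)
Definition binQ (n : N) : rat := (nat_of_bin n)%:R.
Arguments binQ n%_num.

Definition g_poly : {poly rat} :=
  'X^24 + (binQ 3852443469645611961262219752967766016
           / binQ 384257037754753807138505851908147025) *: ('X^2 + 1).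

Definition f_poly : {poly rat} :=
  'X^24 - binQ 24 *: 'X^22 + binQ 8 *: 'X^21 + binQ 252 *: 'X^20
  - binQ 168 *: 'X^19 - binQ 1484 *: 'X^18 - binQ 627 *: 'X^17
  + binQ 26628 *: 'X^16 - binQ 97918 *: 'X^15 + binQ 199671 *: 'X^14
  - binQ 266679 *: 'X^13 + binQ 234997 *: 'X^12
  - binQ 114681 *: 'X^11 - binQ 10107 *: 'X^10 + binQ 63686 *: 'X^9
  - binQ 45384 *: 'X^8 + binQ 6819 *: 'X^7
  + binQ 12880 *: 'X^6 - binQ 12096 *: 'X^5 + binQ 5502 *: 'X^4
  - binQ 1504 *: 'X^3 + binQ 252 *: 'X^2 - binQ 24 *: 'X + 1.

Definition splitting_field_of (p : {poly rat}) (L : splittingFieldType rat) :=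
  splittingFieldFor 1 (map_poly (in_alg L) p) {:L}.

Lemma splitting_field_exists (p : {poly rat}) :
  p != 0 -> exists L, splitting_field_of p L.
Proof.
move=> p0.
have [r Dr] := closed_field_poly_normal (map_poly (ratr : rat -> algC) p).
have [Qs [QsC [s1 Ds1 gen]]] := num_field_exists r.
have split : splittingFieldFor 1 (map_poly (in_alg Qs) p) {:Qs}.
  exists s1 => //; rewrite -(eqp_map QsC) -map_poly_comp.
  rewrite (eq_map_poly (g := ratr)); last first.
    by move=> a /=; rewrite -[RHS](fmorph_rat QsC) // alg_num_field.
  rewrite Dr rmorph_prod /= -Ds1 big_map.
  rewrite [X in _ %= X](eq_bigr (fun z => 'X - (QsC z)%:P)); last first.
    by move=> z _; rewrite rmorphB /= map_polyX map_polyC.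
  by rewrite eqp_scale // lead_coef_eq0 map_poly_eq0.
have ax : SplittingField.axiom Qs.
  exists (map_poly (in_alg Qs) p) => //.
  by apply/polyOver1P; exists p.
pose H := FieldExt_isSplittingField.Build rat Qs ax.
pose L : splittingFieldType rat := HB.pack Qs H.
by exists L.
Qed.

(* Main.v *)
Require Import Defs.
From Stdlib Require Import ZArith.
From HB Require Import structures.
From mathcomp Require Import all_boot all_order all_algebra.
From mathcomp Require Import all_fingroup all_solvable all_field.
From mathcomp Require Import ssrZ zify ring.
From mathcomp Require boolp classical_sets.

(** Let kappa(x) = (x^3 - 3x + 1)/(x^2 - x).  Its fibre over c is the set of
    roots of Shanks' simplest cubic X^3 - cX^2 + (c - 3)X + 1, which
    tau(x) = 1/(1 - x) permutes cyclically.  With p(T) = T^8 - 2139 T + 6489 one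
    has f(x) = (x^2 - x)^8 p(kappa(x)), and g(x) = h(x^2) with
    h(Y) = Y^12 + aY + a and a the square of a rational number.  Hence the 24
    roots of f lie in triples over the eight roots of p, those of g in pairs
    over the twelve roots of h.  Galois automorphisms commute with tau and with
    negation, so they act on the roots through the two wreath products
    ([cover_structure], [wreath_action], [cube_action]): corners are the roots
    of p, edges are the roots of h.  The roots of g are multiplied throughout
    by the denominator of the square root of a, which makes them integral.

    The image lies in the cube group because three numbers are rational.

    - Let theta^2 = theta - 1, a primitive sixth root of unity.  Then
      (x - theta)^3 = (x^2 - x)(kappa(x) - 3 theta), and
      p(3 theta) = 24 (1 + theta)^3, so the cube of the product of the
      xi_i - theta, with xi_i a chosen root of f in each triple, is a scalar
      times (1 + theta)^3; as tau multiplies x - theta by theta up to a scalar,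
      an automorphism with corner twists x_i multiplies this product by theta to
      the power of the sum of the x_i, up to a scalar, and this forces that sum
      to be 0 modulo 3 ([sum_x_eq0]).
    - The product of chosen square roots of the roots of h is a square root of
      the constant term of h, a rational square, so it is fixed and the edge
      flips have sum 0 ([sum_y_eq0]).
    - The product of the discriminants of p and h is a rational square, so the
      corner and edge permutations have the same sign ([sign_eq]).

    The image is everything because Frobenius elements provide enough cycle
    types.  For each prime P there are a ring morphism phi from the algebraic
    integers of L to a field of characteristic P and an automorphism s such that
    phi (s a) = phi (a)^P ([frobenius_lift]); factorizations modulo P then
    describe the permutations of s ([card_fixed_moved]).

    - Modulo 233, p and h have factors of degrees 1 + 7 and 1 + 11: the
      stabilizer of a root is transitive on the others.  Moreover, the cubic over
      the root 16 of p is irreducible, so the fixed corner is twisted.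
    - Modulo 439, the ninth power of Frobenius is a transposition on corners and
      on edges; its 54th power fixes all corners and edges, and flips exactly the
      two edges of the transposition.
    - Modulo 97, neither p nor h has a root: no root is fixed.

    The groups of p and of h are thus doubly transitive and contain a
    transposition, so they are the full symmetric groups ([full_symmetric]).
    The seventh power of Frobenius at 233 moves edges but no corner, so the even
    edge permutations are obtained with corners in place, by simplicity of the
    alternating group ([normal_contains_Alt]).  Its 154th power is a
    nonconstant pure corner twist, the 162nd power of Frobenius at 439 a
    nonconstant pure edge flip; under the symmetric groups either one generates
    all vectors of sum 0 ([perm_stable_sum_zero]).  [rubik_criterion] combines
    these facts. *)

Set Implicit Arguments.
Unset Strict Implicit.
Unset Printing Implicit Defensive.

Import GroupScope GRing.Theory Num.Theory.
Local Open Scope ring_scope.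
(* The key Z is taken by the scope of int. *)
Delimit Scope Z_scope with ZZ.

(** * Algebraic integers and lifts of Frobenius *)

Definition proper_ideal_over (R : comNzRingType) (u : R) (I : R -> Prop) :=
  [/\ I u, ~ I 1 & forall a x y, I x -> I y -> I (a * x + y)].

(** Zorn's lemma on the proper ideals containing u, ordered by inclusion; a
    chain is bounded by its union, and the empty chain by the ideal uR. *)
Lemma maximal_ideal_exists (R : comNzRingType) (u : R) :
    (forall v, u * v <> 1) ->
  exists2 I, proper_ideal_over u I &
    forall J, proper_ideal_over u J -> (forall x, I x -> J x) ->
      forall x, J x -> I x.
Proof.
move=> u_nonunit.
pose T := {I : R -> Prop | proper_ideal_over u I}.
pose le (I J : T) := boolp.asbool (forall x, sval I x -> sval J x).
have I0P : proper_ideal_over u (fun x => exists v, x = u * v).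
  split; first by exists 1; rewrite mulr1.
    by case=> v /esym/u_nonunit.
  by move=> a _ _ [v ->] [w ->]; exists (a * v + w); rewrite mulrDr mulrCA.
have [//|||[I IP] maxI] := @classical_sets.ZL_preorder T (exist _ _ I0P) le.
- by move=> I; apply/boolp.asboolP.
- by move=> J I K /boolp.asboolP IJ /boolp.asboolP JK; apply/boolp.asboolP; auto.
- move=> A chainA.
  have [[K0 AK0]|A0] := boolp.pselect (exists K, A K); last first.
    by exists (exist _ _ I0P) => K AK; case: A0; exists K.
  have UP : proper_ideal_over u (fun x => exists2 K, A K & sval K x).
    split; first by exists K0 => //; case: (svalP K0).
      by case=> K _; case: (svalP K).
    move=> a x y [K AK Kx] [K' AK' Ky].
    have [/boolp.asboolP KK'|/boolp.asboolP K'K] := chainA _ _ AK AK'.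
      by exists K' => //; case: (svalP K') => _ _; apply=> //; apply: KK'.
    by exists K => //; case: (svalP K) => _ _; apply=> //; apply: K'K.
  by exists (exist _ _ UP) => K AK; apply/boolp.asboolP => x Kx; exists K.
exists I => // J JP IJ x Jx.
by have /boolp.asboolP := maxI (exist _ J JP) (introT (boolp.asboolP _) IJ); apply.
Qed.

(** The quotient by a maximal ideal containing u; inverses come from
    maximality: if x is not in I then Rx + I contains 1. *)
Lemma residue_field (R : comNzRingType) (u : R) :
    (forall v, u * v <> 1) ->
  exists (k : fieldType) (phi : {rmorphism R -> k}), phi u = 0.
Proof.
move=> /maximal_ideal_exists[I0 [I0u I01 I0c] maxI].
pose I : pred R := fun x => boolp.asbool (I0 x).
have I00 : I0 0 by rewrite -(addNr u) -mulN1r; apply: I0c.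
have clI : idealr_closed I.
  split; first exact/boolp.asboolP.
    by apply/negP => /boolp.asboolP.
  by move=> a x y /boolp.asboolP Ix /boolp.asboolP Iy; apply/boolp.asboolP/I0c.
pose HI := isIdealr.Build R I clI.
pose J : idealr R := HB.pack I HI.
pose Q : comNzRingType := {ideal_quot J}.
pose phi : {rmorphism R -> Q} := \pi_Q%qT.
have inv_ex (x : Q) : exists y, (x == 0) || (y * x == 1).
  have [->|nzx] := eqVneq x 0; first by exists 0.
  suff [a [b Ib e]] : exists a, exists2 b, I0 b & a * generic_quotient.repr x + b = 1.
    exists (phi a); apply/eqP; rewrite -[x]generic_quotient.reprK.
    rewrite -[LHS](rmorphM phi) -(rmorph1 phi).
    apply/eqP; rewrite -Quotient.idealrBE -e opprD addNKr.
    by rewrite rpredN; apply/boolp.asboolP.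
  pose K y := exists a, exists2 b, I0 b & y = a * generic_quotient.repr x + b.
  apply: boolp.contrapT => noab.
  have KP : proper_ideal_over u K.
    split; first by exists 0, u; rewrite // mul0r add0r.
      by case=> a [b Ib e]; apply: noab; exists a, b.
    move=> a _ _ [b [c Ic ->]] [b' [c' Ic' ->]]; exists (a * b + b'), (a * c + c').
      exact: I0c.
    by rewrite mulrDl mulrDr mulrA addrACA.
  have: I0 (generic_quotient.repr x).
    apply: (maxI K KP).
      by move=> y Iy; exists 0, y; rewrite // mul0r add0r.
    by exists 1, 0; rewrite // mul1r addr0.
  move=> Ix; case/eqP: nzx; rewrite -[x]generic_quotient.reprK -(rmorph0 phi).
  by apply/eqP; rewrite -Quotient.idealrBE subr0; apply/boolp.asboolP.
pose inv x : Q := if x == 0 then 0 else xchoose (inv_ex x).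
have mulVq : forall x, x != 0 -> inv x * x = 1.
  move=> x nzx; rewrite /inv ifN //; apply/eqP.
  by have /orP[/idPn|] := xchooseP (inv_ex x).
have inv0 : inv 0 = 0 by rewrite /inv ifT ?eqxx.
pose HF := GRing.ComNzRing_isField.Build Q mulVq inv0.
pose k : fieldType := HB.pack Q HF.
exists k, (phi : {rmorphism R -> k}).
rewrite -[RHS](rmorph0 phi); apply/eqP.
by rewrite -Quotient.idealrBE subr0; apply/boolp.asboolP.
Qed.

Section AlgebraicIntegers.
Variable L : splittingFieldType rat.

(** Membership is a classical boolean, so that the algebraic integers of L form
    a subtype carrying a commutative ring structure. *)
Definition is_algint : pred L :=
  fun x => boolp.asbool (integralOver (intr : int -> L) x).

Lemma is_algintP x : reflect (integralOver (intr : int -> L) x) (is_algint x).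
Proof. exact: boolp.asboolP. Qed.

Lemma is_algint_subring : subring_closed is_algint.
Proof.
split; first exact/is_algintP/integral1.
  by move=> x y /is_algintP ix /is_algintP iy; apply/is_algintP/integral_sub.
by move=> x y /is_algintP ix /is_algintP iy; apply/is_algintP/integral_mul.
Qed.
HB.instance Definition _ :=
  GRing.isSubringClosed.Build L is_algint is_algint_subring.

Record algint := Algint { algint_val :> L; _ : algint_val \in is_algint }.
HB.instance Definition _ := [isSub for algint_val].
HB.instance Definition _ := [Choice of algint by <:].
HB.instance Definition _ := [SubChoice_isSubComNzRing of algint by <:].

Lemma algintE (x : algint) : integralOver (intr : int -> L) (val x).
Proof. exact/is_algintP/(valP x). Qed.

Lemma algint_lift x : integralOver (intr : int -> L) x ->
  {a : algint | val a = x}.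
Proof. by move=> /is_algintP ix; exists (Algint ix). Qed.

Lemma integral_gal (s : gal_of {:L}) x :
  integralOver (intr : int -> L) x -> integralOver (intr : int -> L) (s x).
Proof.
move=> [p pmon px]; exists p => //.
have -> : map_poly intr p = map_poly s (map_poly intr p : {poly L}).
  by rewrite -map_poly_comp; apply: eq_map_poly => n /=; rewrite rmorph_int.
exact: rmorph_root.
Qed.

Definition gal_algint (s : gal_of {:L}) (x : algint) : algint :=
  Algint (introT (is_algintP _) (integral_gal s (algintE x))).

Lemma val_gal_algint s x : val (gal_algint s x) = s (val x). Proof. by []. Qed.

Fact gal_algint_is_zmod_morphism s : zmod_morphism (gal_algint s).
Proof. by move=> x y; apply: val_inj; rewrite /= rmorphB. Qed.
HB.instance Definition _ s :=
  GRing.isZmodMorphism.Build algint algint (gal_algint s)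
    (gal_algint_is_zmod_morphism s).
Fact gal_algint_is_monoid_morphism s : monoid_morphism (gal_algint s).
Proof.
by split=> [|x y]; apply: val_inj; rewrite /= ?rmorph1 ?rmorphM.
Qed.
HB.instance Definition _ s :=
  GRing.isMonoidMorphism.Build algint algint (gal_algint s)
    (gal_algint_is_monoid_morphism s).

Lemma galois_rat : galois 1 {:L}.
Proof.
rewrite /galois sub1v normalFieldf andbT /=.
apply/separableP => x _; apply: pcharf0_separable => p.
by rewrite pchar_lalg pchar_num.
Qed.

Lemma gal_fixed_rat (x : L) :
  (forall s : gal_of {:L}, s x = x) -> exists r : rat, x = r%:A.
Proof.
move=> fix_x; have: x \in fixedField 'Gal({:L} / 1).
  by apply/fixedFieldP => [|s _]; [exact: memvf | exact: fix_x].
by rewrite (galois_fixedField galois_rat) => /vlineP.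
Qed.

(** The rational root theorem, read off from the corresponding statement on
    algebraic numbers. *)
Lemma rat_algint (r : rat) :
  integralOver (intr : int -> L) (r%:A) -> exists m : int, r = m%:~R.
Proof.
case=> p pmon pr.
have {}pr : root (map_poly intr p) r.
  rewrite -(fmorph_root (in_alg L)) -map_poly_comp.
  rewrite (eq_map_poly (g := intr)) // => n /=.
  by rewrite -[LHS]/(in_alg L _) rmorph_int.
have: (ratr r : algC) \is a Num.int.
  apply: Cint_rat_Aint; first exact: Crat_rat.
  apply: (@root_monic_Aint (map_poly intr p)).
  - rewrite -(fmorph_root (@ratr algC)) -map_poly_comp in pr.
    by rewrite (eq_map_poly (g := ratr \o intr)) // => n /=; rewrite ratr_int.
  - exact: monic_map.
  by apply/polyOverP => i; rewrite coef_map /= intr_int.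
case/intrP => m e; exists m; apply: (fmorph_inj (@ratr algC)).
by rewrite [LHS]e; apply: esym; exact: rmorph_int.
Qed.

(** The Galois group fixes only rational numbers, and the integers are
    integrally closed. *)
Lemma gal_fixed_int (x : algint) :
  (forall s, gal_algint s x = x) -> exists m : int, x = m%:~R.
Proof.
move=> fix_x.
have [s|r xr] := @gal_fixed_rat (val x).
  by rewrite -val_gal_algint fix_x.
have [m rm] : exists m : int, r = m%:~R.
  by apply: rat_algint; rewrite -xr; apply: algintE.
exists m; apply: val_inj.
by rewrite rmorph_int xr rm -[RHS](rmorph_int (in_alg L)).
Qed.

(** The inverse of P would be a rational algebraic integer, hence an integer;
    consequently a residue field of characteristic P exists. *)
Lemma algint_prime_nonunit P (v : algint) : prime P -> P%:R * v <> 1.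
Proof.
move=> prP e.
have e' : P%:R * val v = 1 by rewrite -(rmorph_nat (val : algint -> L)) -rmorphM e.
have nzP : P%:R != 0 :> L by apply: contra_eq_neq e' => ->; rewrite mul0r eq_sym oner_neq0.
have [m Pm] : exists m : int, (P%:R^-1 : rat) = m%:~R.
  apply: rat_algint; rewrite -[_%:A]/(in_alg L _) fmorphV rmorph_nat.
  suff -> : P%:R^-1 = val v by apply: algintE.
  by rewrite -[LHS]mulr1 -[X in _ * X = _]e' mulKf.
have: (P%:Z * m = 1)%R.
  apply: (@intr_inj rat); rewrite rmorphM /= -Pm divff //.
  by rewrite pnatr_eq0 -lt0n prime_gt0.
move/(congr1 absz); rewrite abszM /= => /eqP; rewrite muln_eq1 => /andP[/eqP P1 _].
by rewrite P1 in prP.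
Qed.

(** Given one element a, the product of the X - s(a) over all s has integer
    coefficients, so its image under phi is unchanged by raising coefficients to
    the power P; as phi(a) is a root of this image, so is phi(a)^P, that is
    phi(a)^P = phi(s a) for some s.  To get the same s for all a, it suffices to
    treat finitely many elements together, one potential counterexample for each
    s: they are packed as the coefficients of a polynomial A, and the argument
    is applied to A. *)
Theorem frobenius_lift P : prime P ->
  exists (k : fieldType) (phi : {rmorphism algint -> k}) (s : gal_of {:L}),
    P%:R = 0 :> k /\ forall a, phi (gal_algint s a) = phi a ^+ P.
Proof.
move=> prP.
have [v|k [phi phiP]] := @residue_field algint P%:R; first exact: algint_prime_nonunit.
rewrite rmorph_nat in phiP.
exists k, phi.
have chP : P \in [pchar k] by rewrite inE prP phiP eqxx.
suff frob (a : gal_of {:L} -> algint) : exists s : gal_of {:L},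
    forall i, phi (gal_algint s (a i)) = phi (a i) ^+ P.
  apply: boolp.contrapT => nofrob.
  have bad s : exists a, phi (gal_algint s a) <> phi a ^+ P.
    apply: boolp.contrapT => nobad; apply: nofrob; exists s; split=> // a.
    by apply: boolp.contrapT => bada; apply: nobad; exists a.
  have [a bada] := boolp.choice bad.
  by have [s /(_ s)] := frob a; apply: bada.
(* One s for the whole family a: take its members as coefficients. *)
pose A : {poly algint} := \sum_i a i *: 'X^(enum_rank i).
have coefA i : A`_(enum_rank i) = a i.
  rewrite coef_sum (bigD1 i) //= coefZ coefXn eqxx mulr1 big1 ?addr0 // => j nji.
  by rewrite coefZ coefXn eqn_leq -eqn_leq (inj_eq val_inj) (inj_eq enum_rank_inj)
             eq_sym (negPf nji) mulr0.
pose q : {poly {poly algint}} :=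
  \prod_(s : gal_of {:L}) ('X - (map_poly (gal_algint s) A)%:P).
have qfix t : map_poly (map_poly (gal_algint t)) q = q.
  rewrite rmorph_prod [RHS](reindex_inj (mulIg t)) /=; apply: eq_bigr => s _.
  rewrite rmorphB /= map_polyX map_polyC /=; congr ('X - _%:P).
  rewrite -map_poly_comp; apply: eq_map_poly => x /=.
  by apply: val_inj; rewrite /= galM ?memvf.
have qint i j : exists m : int, q`_i`_j = m%:~R.
  apply: gal_fixed_int => t; rewrite -[in RHS](qfix t).
  by rewrite coef_map /= coef_map.
(* Frobenius on coefficients only; it fixes X. *)
pose F : {poly k} -> {poly k} := map_poly (pFrobenius_aut chP).
pose Q := map_poly (map_poly phi) q.
have QF : map_poly F Q = Q.
  apply/polyP => i; rewrite [LHS]coef_map /=; apply/polyP=> j.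
  rewrite coef_map [Q`_i]coef_map /= coef_map /=.
  by have [m ->] := qint i j; rewrite rmorph_int pFrobenius_aut_int.
have Qprod : Q = \prod_(s : gal_of {:L})
    ('X - (map_poly phi (map_poly (gal_algint s) A))%:P).
  rewrite /Q rmorph_prod /=; apply: eq_bigr => s _.
  by rewrite rmorphB /= map_polyX map_polyC.
pose B := map_poly phi A.
have QB : Q.[B] = 0.
  rewrite Qprod horner_prod (bigD1 1%g) //= !hornerE.
  suff -> : map_poly (gal_algint 1%g) A = A by rewrite subrr mul0r.
  apply: map_poly_id => x _.
  by apply: val_inj; rewrite /= gal_id.
have: Q.[F B] == 0.
  by rewrite -QF horner_map QB rmorph0.
rewrite Qprod horner_prod => /prodf_eq0[s _].
rewrite !hornerE subr_eq0 => /eqP FB; exists s => i.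
move/(congr1 (fun p : {poly k} => p`_(enum_rank i))): FB.
by rewrite !coef_map /= coefA pFrobenius_autE => ->.
Qed.
End AlgebraicIntegers.

(** * Integer polynomials by computation *)

Fact zr_key : unit. Proof. exact: tt. Qed.

Section ZPoly.
Implicit Types (a b : seq Z).

Fixpoint padd a b := match a, b with
  | c :: a', d :: b' => Z.add c d :: padd a' b'
  | [::], _ => b
  | _, [::] => a
  end.
Definition pscale (c : Z) a := map (Z.mul c) a.
Fixpoint pmul a b :=
  if a is c :: a' then padd (pscale c b) (Z0 :: pmul a' b) else [::].
Definition pmod (P : Z) a := map (fun c => Z.modulo c P) a.
Definition psub a b := padd a (map Z.opp b).
Definition peq a b := all (fun c => Z.eqb c 0) (psub a b).
Definition peqmod P a b := all (fun c => Z.eqb c 0) (pmod P (psub a b)).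
Definition ppow a n := iter n (pmul a) [:: Zpos xH].
Definition trinomial n (b c : Z) : seq Z := [:: c, b & nseq n Z0].
Definition double (a : seq Z) : seq Z := flatten [seq [:: c; Z0] | c <- a].
Definition pderiv (a : seq Z) : seq Z :=
  [seq Z.mul (Z.of_nat i) (nth Z0 a i) | i <- iota 1 (size a).-1].
Definition pX : seq Z := [:: Z0; Zpos xH].

(** A single step X^n = -q suffices for the lists of length at most n + 1 that
    [mulmod] produces; the value at a root of X^n + q modulo P is
    preserved in all cases. *)
Definition reduce (P : Z) q a :=
  let n := size q in
  pmod P (psub (take n a) (pmul (drop n a) q)).
Fixpoint mulmod P q a b :=
  if a is c :: a' then reduce P q (padd (pscale c b) (Z0 :: mulmod P q a' b))
  else [::].
Fixpoint powmod P q a (n : positive) := match n with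
  | xH => a
  | xO m => let b := powmod P q a m in mulmod P q b b
  | xI m => let b := powmod P q a m in mulmod P q a (mulmod P q b b)
  end.
(** X^(P^m) modulo P and the monic polynomial with low coefficients q. *)
Definition frobmod (P : positive) q m :=
  iter m (fun a => powmod (Zpos P) q a P) pX.
(** A monic polynomial is stored as the list of its coefficients below the
    leading one, lowest degree first. *)
Definition monicZ q := rcons q (Zpos xH).

Section Eval.
Variable A : comNzRingType.
Implicit Type x : A.

Definition zr_def (c : Z) : A := (int_of_Z c)%:~R.
(** Locked, so that simplification never turns a binary integer into a sum
    of ones. *)
Definition zr := locked_with zr_key zr_def.

Lemma zrE c : zr c = (int_of_Z c)%:~R.
Proof. by rewrite /zr unlock. Qed.
Lemma zrD c d : zr (Z.add c d) = zr c + zr d.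
Proof. by rewrite !zrE -rmorphD -(rmorphD int_of_Z). Qed.
Lemma zrM c d : zr (Z.mul c d) = zr c * zr d.
Proof. by rewrite !zrE -rmorphM -(rmorphM int_of_Z). Qed.
Lemma zrN c : zr (Z.opp c) = - zr c.
Proof. by rewrite !zrE -rmorphN -(rmorphN int_of_Z). Qed.
Lemma zr0 : zr Z0 = 0. Proof. by rewrite zrE. Qed.
Lemma zr1 : zr (Zpos xH) = 1. Proof. by rewrite zrE. Qed.
Lemma zr_pos P : zr (Zpos P) = (Pos.to_nat P)%:R. Proof. by rewrite zrE. Qed.

Lemma zr_mod P c : zr P = 0 -> zr (Z.modulo c P) = zr c.
Proof.
have [->|nzP] := Z.eq_dec P Z0; first by rewrite Zmod_0_r.
move=> P0; have /(congr1 zr) := Z.div_mod c P nzP.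
by rewrite zrD zrM P0 mul0r add0r => ->.
Qed.

(** The Horner value, in any commutative ring A: at 'X it is the polynomial
    itself, at a root it is the evaluation, and ring morphisms commute with it.
    Thus one computation on lists serves L, L[theta] and the residue
    fields. *)
Fixpoint ev a x : A := if a is c :: a' then zr c + x * ev a' x else 0.

Lemma ev_add a b x : ev (padd a b) x = ev a x + ev b x.
Proof.
elim: a b => [|c a IHa] [|d b] /=; rewrite ?add0r ?addr0 //.
by rewrite zrD IHa mulrDr addrACA.
Qed.

Lemma ev_scale c a x : ev (pscale c a) x = zr c * ev a x.
Proof.
by elim: a => [|d a IHa] /=; rewrite ?mulr0 // zrM IHa mulrDr mulrCA.
Qed.

Lemma ev_opp a x : ev (map Z.opp a) x = - ev a x.
Proof.
by elim: a => [|d a IHa] /=; rewrite ?oppr0 // zrN IHa opprD mulrN.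
Qed.

Lemma ev_sub a b x : ev (psub a b) x = ev a x - ev b x.
Proof. by rewrite ev_add ev_opp. Qed.

Lemma ev_mul a b x : ev (pmul a b) x = ev a x * ev b x.
Proof.
elim: a => [|c a IHa] /=; first by rewrite mul0r.
by rewrite ev_add ev_scale /= zr0 add0r IHa mulrDl mulrA.
Qed.

Lemma ev_pow a n x : ev (ppow a n) x = ev a x ^+ n.
Proof.
elim: n => [|n IHn]; first by rewrite /= zr1 mulr0 addr0.
by rewrite exprS -IHn -ev_mul.
Qed.

Lemma ev_cat a b x : ev (a ++ b) x = ev a x + x ^+ size a * ev b x.
Proof.
elim: a => [|c a IHa] /=; first by rewrite mul1r add0r.
by rewrite IHa exprS mulrDr addrA mulrA.
Qed.

Lemma ev_monic q x : ev (monicZ q) x = ev q x + x ^+ size q.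
Proof. by rewrite /monicZ -cats1 ev_cat /= zr1 mulr0 addr0 mulr1. Qed.

Lemma ev_X x : ev pX x = x.
Proof. by rewrite /= zr0 zr1 mulr0 addr0 mulr1 add0r. Qed.

Lemma ev_eq a b x : peq a b -> ev a x = ev b x.
Proof.
move=> e; apply/eqP; rewrite -subr_eq0 -ev_sub; apply/eqP.
move: e; rewrite /peq; elim: (psub a b) => //= c s IHs /andP[/Z.eqb_eq-> /IHs->].
by rewrite zr0 mulr0 addr0.
Qed.

Section Mod.
Variables (P : Z) (P0 : zr P = 0).

Lemma ev_mod a x : ev (pmod P a) x = ev a x.
Proof. by elim: a => //= c a ->; rewrite zr_mod. Qed.

Lemma ev_eqmod a b x : peqmod P a b -> ev a x = ev b x.
Proof.
move=> e; apply/eqP; rewrite -subr_eq0 -ev_sub -ev_mod; apply/eqP.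
move: e; rewrite /peqmod.
elim: (pmod _ _) => //= c s IHs /andP[/Z.eqb_eq-> /IHs->].
by rewrite zr0 mulr0 addr0.
Qed.

Variables (q : seq Z) (x : A).
Hypothesis qx : ev (monicZ q) x = 0.

Lemma ev_reduce a : ev (reduce P q a) x = ev a x.
Proof.
rewrite /reduce ev_mod ev_sub ev_mul.
rewrite -[in RHS](cat_take_drop (size q) a) ev_cat.
have [a_small|q_small] := leqP (size a) (size q).
  by rewrite drop_oversize //= mul0r mulr0 subr0 addr0.
have xn : x ^+ size q = - ev q x.
  by apply/eqP; rewrite -addr_eq0 addrC -ev_monic qx.
by rewrite size_take q_small xn mulNr mulrC.
Qed.

Lemma ev_mulmod a b : ev (mulmod P q a b) x = ev a x * ev b x.
Proof.
elim: a => [|c a IHa] /=; first by rewrite mul0r.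
by rewrite ev_reduce ev_add ev_scale /= zr0 add0r IHa mulrDl mulrA.
Qed.

Lemma ev_powmod a n : ev (powmod P q a n) x = ev a x ^+ Pos.to_nat n.
Proof.
elim: n => [n IHn|n IHn|] /=; last by rewrite expr1.
  by rewrite !ev_mulmod IHn -expr2 -exprM Pos2Nat.inj_xI exprS mulnC multE.
by rewrite !ev_mulmod IHn -expr2 -exprM Pos2Nat.inj_xO mulnC multE.
Qed.
End Mod.

Lemma ev_frobmod P q m x : zr (Zpos P) = 0 -> ev (monicZ q) x = 0 ->
  ev (frobmod P q m) x = x ^+ (Pos.to_nat P ^ m).
Proof.
move=> P0 qx; elim: m => [|m IHm]; first by rewrite ev_X expr1.
by rewrite [frobmod _ _ _]/= ev_powmod // IHm -exprM expnSr.
Qed.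
End Eval.

Lemma rmorph_zr (A B : comNzRingType) (f : {rmorphism A -> B}) c : f (zr A c) = zr B c.
Proof. by rewrite !zrE rmorph_int. Qed.

Lemma rmorph_ev (A B : comNzRingType) (f : {rmorphism A -> B}) a x :
  f (ev a x) = ev a (f x).
Proof.
by elim: a => [|c a IHa] /=; rewrite ?rmorph0 // rmorphD rmorphM IHa rmorph_zr.
Qed.

End ZPoly.

Lemma zr_nat (A : comNzRingType) n : zr A (Z.of_nat n) = n%:R.
Proof. by rewrite zrE (Z_of_intK (Posz n)). Qed.

Lemma coef_ev (A : comNzRingType) (a : seq Z) i :
  (ev a 'X : {poly A})`_i = zr A (nth Z0 a i).
Proof.
elim: a i => [|c a IHa] [|i] /=; rewrite ?coef0 ?zr0 // coefD coefXM /=.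
  by rewrite addr0 -(rmorph_zr polyC) coefC.
by rewrite -(rmorph_zr polyC) coefC add0r IHa.
Qed.

Lemma horner_ev (A : comNzRingType) a (x : A) : (ev a 'X).[x] = ev a x.
Proof. by rewrite -/(horner_eval x _) rmorph_ev /= /horner_eval hornerX. Qed.

Lemma map_ev (A B : comNzRingType) (f : {rmorphism A -> B}) a :
  map_poly f (ev a 'X) = ev a 'X.
Proof. by rewrite (rmorph_ev (map_poly f)) /= map_polyX. Qed.

Lemma size_ev (A : comNzRingType) a : (size (ev a 'X : {poly A}) <= size a)%N.
Proof. by apply/leq_sizeP => i ge_i; rewrite coef_ev nth_default ?zr0. Qed.

Lemma size_ev_monic (A : comNzRingType) a :
  size (ev (monicZ a) 'X : {poly A}) = (size a).+1.
Proof.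
by rewrite ev_monic addrC size_polyDl size_polyXn // ltnS size_ev.
Qed.

Lemma ev_monic_monic (A : comNzRingType) a : (ev (monicZ a) 'X : {poly A}) \is monic.
Proof.
by rewrite qualifE /= ev_monic addrC lead_coefDl ?lead_coefXn // size_polyXn ltnS size_ev.
Qed.

Lemma integral_ev (K : fieldType) a (x : K) :
  ev (monicZ a) x = 0 -> integralOver (intr : int -> K) x.
Proof.
move=> ax; exists (ev (monicZ a) 'X); first exact: ev_monic_monic.
by rewrite /root rmorph_ev /= map_polyX horner_ev ax.
Qed.

Lemma zr_neg (A : comNzRingType) P : zr A (Zneg P) = - zr A (Zpos P).
Proof. exact: (zrN A (Zpos P)). Qed.

Lemma ev_double (A : comNzRingType) a (x : A) : ev (double a) x = ev a (x ^+ 2).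
Proof.
by elim: a => //= c a IHa; rewrite -/(double a) IHa zr0 add0r expr2 mulrA.
Qed.

Lemma ev_monic_double (A : comNzRingType) a (x : A) :
  ev (monicZ (double a)) x = ev (monicZ a) (x ^+ 2).
Proof.
rewrite !ev_monic ev_double -exprM; congr (_ + _ ^+ _).
by elim: a => //= c a IHa; rewrite -/(double a) IHa mulnS.
Qed.

Lemma ev_monic_trinomial (A : comNzRingType) n b c (x : A) :
  ev (monicZ (trinomial n b c)) x = x ^+ n.+2 + zr A b * x + zr A c.
Proof.
have ev0 : ev (nseq n Z0) x = 0 by elim: n => //= n ->; rewrite zr0 mulr0 addr0.
by rewrite ev_monic /= size_nseq ev0 mulr0 addr0 addrC [_ * x]mulrC addrAC addrA.
Qed.

Lemma zr_exp (A : comNzRingType) c (e : positive) :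
  zr A (Z.pow c (Zpos e)) = zr A c ^+ Pos.to_nat e.
Proof.
rewrite -positive_nat_Z; move: (Pos.to_nat e) => n.
elim: n => [|n IHn]; first exact: zr1.
by rewrite Nat2Z.inj_succ Z.pow_succ_r ?zrM ?IHn ?exprS //; apply: Nat2Z.is_nonneg.
Qed.

Lemma deriv_ev (A : comNzRingType) (a : seq Z) :
  (ev a 'X : {poly A})^`() = ev (pderiv a) 'X.
Proof.
apply/polyP => i; rewrite coef_deriv !coef_ev /pderiv.
have [lt_i|ge_i] := ltnP i (size a).-1.
  by rewrite (nth_map 0%N) ?size_iota // nth_iota // zrM add1n zr_nat mulr_natl.
rewrite [in RHS]nth_default ?size_map ?size_iota // nth_default ?zr0 ?mul0rn //.
by rewrite (leq_trans (leqSpred _)) ?ltnS.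
Qed.

(** Facts on Frobenius at the roots of q modulo P that can be checked by
    computation: X^(P^m) is X or -X modulo q, or X^(P^m) - X is prime to q, or q
    is separable.  In the last two cases u and v are the coefficients of a Bezout
    identity. *)
Definition fix_cert P q m :=
  peqmod (Zpos P) (frobmod P q m) (reduce (Zpos P) q pX).
Definition neg_cert P q m :=
  peqmod (Zpos P) (frobmod P q m) (map Z.opp pX).
Definition nofix_cert P q m u v :=
  peqmod (Zpos P) (padd (pmul u (psub (frobmod P q m) pX)) (pmul v (monicZ q)))
    [:: Zpos xH].

Definition sep_cert P q u v :=
  peqmod (Zpos P) (padd (pmul u (monicZ q)) (pmul v (pderiv (monicZ q))))
    [:: Zpos xH].

Section Cert.
Variables (A : comNzRingType) (P : positive).
Hypothesis P0 : zr A (Zpos P) = 0.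

Lemma fix_certP q m x : fix_cert P q m -> ev (monicZ q) x = 0 :> A ->
  x ^+ (Pos.to_nat P ^ m) = x.
Proof.
move=> cert qx; rewrite -(ev_frobmod m P0 qx) (ev_eqmod P0 _ cert).
by rewrite ev_reduce ?ev_X.
Qed.

Lemma neg_certP q m x : neg_cert P q m -> ev (monicZ q) x = 0 :> A ->
  x ^+ (Pos.to_nat P ^ m) = - x.
Proof.
move=> cert qx; rewrite -(ev_frobmod m P0 qx) (ev_eqmod P0 _ cert).
by rewrite ev_opp ev_X.
Qed.

Lemma nofix_certP q m u v x : nofix_cert P q m u v -> ev (monicZ q) x = 0 :> A ->
  x ^+ (Pos.to_nat P ^ m) <> x.
Proof.
move=> cert qx fixx.
have := ev_eqmod P0 x cert; rewrite ev_add !ev_mul qx mulr0 addr0 ev_sub ev_X.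
rewrite (ev_frobmod m P0 qx) fixx subrr mulr0 /= zr1 mulr0 addr0 => /eqP.
by rewrite eq_sym oner_eq0.
Qed.

Lemma sep_certP q u v x : sep_cert P q u v -> ev (monicZ q) x = 0 :> A ->
  ev (pderiv (monicZ q)) x <> 0 :> A.
Proof.
move=> cert qx q'x; have := ev_eqmod P0 x cert.
rewrite ev_add !ev_mul qx q'x !mulr0 addr0 /= zr1 mulr0 addr0 => /eqP.
by rewrite eq_sym oner_eq0.
Qed.
End Cert.

Lemma card_roots (k : idomainType) (I : finType) (x : I -> k) q :
  injective x -> (#|[set i | ev (monicZ q) (x i) == 0%R]| <= size q)%N.
Proof.
move=> injx; set S := [set i | _].
rewrite -ltnS -(size_ev_monic k) cardE -(size_map x); apply: max_poly_roots.
- by rewrite monic_neq0 // ev_monic_monic.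
- by apply/allP => _ /mapP[i iS ->]; rewrite mem_enum inE in iS; rewrite /root horner_ev.
by rewrite map_inj_uniq ?enum_uniq.
Qed.

(** A root occurring twice annihilates the derivative too. *)
Lemma uniq_simple_roots (L : fieldType) (p : {poly L}) rs :
    p = \prod_(r <- rs) ('X - r%:P) ->
    (forall x, p.[x] = 0 -> p^`().[x] = 0 -> False) ->
  uniq rs.
Proof.
move=> pE simple; apply: count_mem_uniq => x.
have [xrs|/count_memPn //] := boolP (x \in rs).
have rs_perm := perm_to_rem xrs; rewrite (seq.permP rs_perm) /= eqxx.
suff /count_memPn -> : x \notin rem x rs by [].
apply/negP => x2; apply: (simple x); rewrite pE (perm_big _ rs_perm) big_cons /=.
  by rewrite hornerM hornerXsubC subrr mul0r.
rewrite derivM !hornerE derivXsubC hornerC subrr mul0r addr0 mul1r.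
by apply/eqP; rewrite -/(root _ _) root_prod_XsubC.
Qed.

(** * The polynomials and their factorizations modulo 97, 233 and 439 *)

(* The coefficient of g is the square of sqrt_num / sqrt_den. *)
Definition sqrt_num : Z := 1962764241992810496%ZZ.
Definition sqrt_den : Z := 619884697145165705%ZZ.
(** With z = (sqrt_den x)^2, the equation g(x) = 0 becomes
    z^12 + h_lin z + h_const = 0, which has integer coefficients. *)
Definition h_lin : Z := (sqrt_num ^ 2 * sqrt_den ^ 20)%ZZ.
Definition h_const : Z := (sqrt_num ^ 2 * sqrt_den ^ 22)%ZZ.
Definition p_low : seq Z := trinomial 6 (-2139)%ZZ 6489%ZZ.
Definition h_low : seq Z := trinomial 10 h_lin h_const.
Definition kappa_num : seq Z := [:: 1; -3; 0; 1]%ZZ.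
Definition kappa_den : seq Z := [:: 0; -1; 1]%ZZ.
Definition f_low : seq Z :=
  [:: 1; -24; 252; -1504; 5502; -12096; 12880; 6819; -45384; 63686; -10107;
      -114681; 234997; -266679; 199671; -97918; 26628; -627; -1484; -168; 252;
      8; -24; 0]%ZZ.
Definition g_low := double h_low.
(** f is the numerator of p composed with kappa. *)
Lemma f_of_p : peq (monicZ f_low)
  (padd (ppow kappa_num 8)
    (padd (pscale (-2139)%ZZ (pmul kappa_num (ppow kappa_den 7)))
       (pscale 6489%ZZ (ppow kappa_den 8)))).
Proof. by vm_compute. Qed.

(** p = (T - 16)(degree 7) and h = (Y + 74)(degree 11) modulo 233; the second
    factors have no root modulo 233, and the seventh and the eleventh power of
    Frobenius are trivial on their respective roots.  The cubic over the root 16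
    of p has no root modulo 233.
    The separability of f and g modulo 233 gives that of f and g over Q. *)
Definition fixed233_p : seq Z := [:: 217]%ZZ.
Definition moved233_p : seq Z := [:: 75; 51; 76; 63; 135; 23; 16]%ZZ.
Definition moved233_p_u : seq Z := [:: 186; 194; 38; 144; 150; 149; 198]%ZZ.
Definition moved233_p_v : seq Z := [:: 71; 38; 177; 204; 181; 59]%ZZ.
Definition fixed233_h : seq Z := [:: 74]%ZZ.
Definition moved233_h : seq Z :=
  [:: 183; 51; 141; 102; 49; 204; 98; 175; 196; 117; 159]%ZZ.
Definition moved233_h_u : seq Z :=
  [:: 1; 108; 54; 195; 108; 33; 119; 228; 185; 131; 231]%ZZ.
Definition moved233_h_v : seq Z :=
  [:: 24; 110; 181; 143; 145; 2; 93; 178; 188; 161]%ZZ.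
Definition cubic233 : seq Z := [:: 1; 13; 217]%ZZ.
Definition cubic233_u : seq Z := [:: 73; 88; 232]%ZZ.
Definition cubic233_v : seq Z := [:: 144; 1]%ZZ.
Definition sep_f_u : seq Z :=
  [:: 113; 230; 138; 23; 11; 230; 225; 24; 111; 109; 89; 57; 78; 84; 96; 224;
     133; 134; 14; 43; 165; 147; 86]%ZZ.
Definition sep_f_v : seq Z :=
  [:: 160; 14; 10; 15; 228; 96; 75; 177; 146; 83; 208; 148; 33; 151; 203; 20;
     201; 96; 126; 121; 36; 10; 23; 210]%ZZ.
Definition sep_g_u : seq Z :=
  [:: 25; 0; 157; 0; 101; 0; 16; 0; 224; 0; 107; 0; 100; 0; 2; 0; 28; 0; 159;
     0; 129; 0; 175]%ZZ.
Definition sep_g_v : seq Z :=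
  [:: 0; 71; 0; 42; 0; 122; 0; 77; 0; 146; 0; 180; 0; 190; 0; 97; 0; 193; 0;
     139; 0; 82; 0; 216]%ZZ.
Definition sep233_p_u : seq Z := [:: 50; 64; 26; 229; 144; 175; 224]%ZZ.
Definition sep233_p_v : seq Z := [:: 97; 52; 225; 55; 117; 215; 182; 205]%ZZ.
Definition sep233_h_u : seq Z :=
  [:: 161; 157; 101; 16; 224; 107; 100; 2; 28; 159; 129]%ZZ.
Definition sep233_h_v : seq Z :=
  [:: 20; 6; 84; 11; 154; 59; 127; 147; 194; 153; 45; 164]%ZZ.
Lemma p_233_order : fix_cert 233 p_low 7. Proof. by vm_compute. Qed.
Lemma h_233_order : fix_cert 233 (pmod 233 h_low) 11. Proof. by vm_compute. Qed.
Lemma p_233_split :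
  peqmod 233 (monicZ p_low) (pmul (monicZ fixed233_p) (monicZ moved233_p)).
Proof. by vm_compute. Qed.
Lemma h_233_split :
  peqmod 233 (monicZ h_low) (pmul (monicZ fixed233_h) (monicZ moved233_h)).
Proof. by vm_compute. Qed.
Lemma p_233_fixed : fix_cert 233 fixed233_p 1. Proof. by vm_compute. Qed.
Lemma h_233_fixed : fix_cert 233 fixed233_h 1. Proof. by vm_compute. Qed.
Lemma p_233_moved : nofix_cert 233 moved233_p 1 moved233_p_u moved233_p_v.
Proof. by vm_compute. Qed.
Lemma h_233_moved : nofix_cert 233 moved233_h 1 moved233_h_u moved233_h_v.
Proof. by vm_compute. Qed.
Lemma cubic_233_moved : nofix_cert 233 cubic233 1 cubic233_u cubic233_v.
Proof. by vm_compute. Qed.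
Lemma f_233_separable : sep_cert 233 f_low sep_f_u sep_f_v.
Proof. by vm_compute. Qed.
Lemma g_233_separable : sep_cert 233 g_low sep_g_u sep_g_v.
Proof. by vm_compute. Qed.
Lemma p_233_separable : sep_cert 233 p_low sep233_p_u sep233_p_v.
Proof. by vm_compute. Qed.
Lemma h_233_separable : sep_cert 233 h_low sep233_h_u sep233_h_v.
Proof. by vm_compute. Qed.

(** The roots of the sextic factor of p and of the factor of degree 10 of h lie
    in the field with 439^9 elements, those of the quadratic factors do not. *)
Definition fixed439_p : seq Z := [:: 251; 68; 363; 303; 86; 206]%ZZ.
Definition moved439_p : seq Z := [:: 206; 233]%ZZ.
Definition moved439_p_u : seq Z := [:: 163; 203]%ZZ.
Definition moved439_p_v : seq Z := [:: 406]%ZZ.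
Definition fixed439_h : seq Z :=
  [:: 438; 120; 59; 296; 184; 280; 170; 326; 403; 44]%ZZ.
Definition moved439_h : seq Z := [:: 216; 395]%ZZ.
Definition moved439_h_u : seq Z := [:: 136; 353]%ZZ.
Definition moved439_h_v : seq Z := [:: 267]%ZZ.
Definition sep439_p_u : seq Z := [:: 24; 122; 108; 110; 47; 56; 431]%ZZ.
Definition sep439_p_v : seq Z := [:: 49; 436; 314; 206; 96; 49; 432; 1]%ZZ.
Definition sep439_h_u : seq Z :=
  [:: 34; 317; 257; 369; 277; 39; 15; 411; 23; 279; 6]%ZZ.
Definition sep439_h_v : seq Z :=
  [:: 26; 363; 376; 381; 79; 233; 326; 328; 295; 181; 306; 219]%ZZ.
Lemma p_439_fixed : fix_cert 439 fixed439_p 9. Proof. by vm_compute. Qed.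
Lemma h_439_fixed : fix_cert 439 fixed439_h 9. Proof. by vm_compute. Qed.
Lemma p_439_moved : nofix_cert 439 moved439_p 9 moved439_p_u moved439_p_v.
Proof. by vm_compute. Qed.
Lemma h_439_moved : nofix_cert 439 moved439_h 9 moved439_h_u moved439_h_v.
Proof. by vm_compute. Qed.
Lemma g_439_fixed : fix_cert 439 (double fixed439_h) 54.
Proof. by vm_compute. Qed.
Lemma g_439_negated : neg_cert 439 (double moved439_h) 54.
Proof. by vm_compute. Qed.
Lemma p_439_split :
  peqmod 439 (monicZ p_low) (pmul (monicZ fixed439_p) (monicZ moved439_p)).
Proof. by vm_compute. Qed.
Lemma h_439_split :
  peqmod 439 (monicZ h_low) (pmul (monicZ fixed439_h) (monicZ moved439_h)).
Proof. by vm_compute. Qed.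
Lemma p_439_separable : sep_cert 439 p_low sep439_p_u sep439_p_v.
Proof. by vm_compute. Qed.
Lemma h_439_separable : sep_cert 439 h_low sep439_h_u sep439_h_v.
Proof. by vm_compute. Qed.
Lemma h_439_const_unit : peqmod 439 (pmul [:: 63%ZZ] [:: h_const]) [:: 1%ZZ].
Proof. by vm_compute. Qed.

(** Neither p nor h has a root modulo 97. *)
Definition nofix97_p_u : seq Z := [:: 24; 77; 40; 10; 27; 82; 6; 28]%ZZ.
Definition nofix97_p_v : seq Z := [:: 82; 8; 93; 26; 48; 1; 12]%ZZ.
Definition nofix97_h_u : seq Z :=
  [:: 19; 92; 96; 55; 28; 10; 93; 61; 7; 57; 67; 94]%ZZ.
Definition nofix97_h_v : seq Z := [:: 95; 33; 65; 3; 56; 74; 33; 35; 86]%ZZ.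
Lemma p_97_moved : nofix_cert 97 p_low 1 nofix97_p_u nofix97_p_v.
Proof. by vm_compute. Qed.
Lemma h_97_moved : nofix_cert 97 (pmod 97 h_low) 1 nofix97_h_u nofix97_h_v.
Proof. by vm_compute. Qed.

Definition disc_p : Z := (8 ^ 8 * 6489 ^ 7 - 7 ^ 7 * (-2139) ^ 8)%ZZ.
Definition disc_h : Z := (12 ^ 12 * sqrt_den ^ 2 - 11 ^ 11 * sqrt_num ^ 2)%ZZ.
Definition sqrt_disc : Z := Z.sqrt (disc_p * disc_h).
Lemma sqrt_discE : (sqrt_disc ^ 2 = disc_p * disc_h)%ZZ.
Proof. by vm_compute. Qed.

(** * Permutations and the cube group *)

Section Perm.
Local Open Scope nat_scope.
Local Open Scope group_scope.
Variable T : finType.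
Implicit Types (H : {group {perm T}}) (s : {perm T}).

(** The order of s divides the prime q, so an orbit has 1 or q elements; the q
    points other than i0 are moved, so they form a single orbit. *)
Lemma prime_cycle_transitive s (q : nat) (i0 : T) :
    prime q -> #|T| = q.+1 -> s ^+ q = 1 ->
    (forall i, (s i == i) = (i == i0)) ->
  forall i j, i != i0 -> j != i0 -> exists m, (s ^+ m) i = j.
Proof.
move=> prq cT sq fixs i j ni nj.
have ord_s : #[s] %| q by rewrite order_dvdn sq.
pose O := orbit 'P <[s]> i.
have sO : O \subset [set~ i0].
  apply/subsetP => _ /orbitP[_ /cycleP[m ->] <-]; rewrite !inE /= /aperm.
  have fixm : (s ^+ m) i0 = i0.
    elim: m => [|m IHm]; first by rewrite perm1.
    by rewrite expgSr permM IHm; apply/eqP; rewrite fixs.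
  by apply: contra ni => /eqP e; apply/eqP/(@perm_inj _ (s ^+ m)); rewrite e.
have cO : #|O| = q.
  have dO : #|O| %| q by rewrite (dvdn_trans _ ord_s) // dvdn_orbit.
  case/primeP: prq => _ /(_ _ dO) /pred2P[/eqP c1|//].
  have /cards1P[x Ox] : #|O| == 1%N by [].
  have: i \in O by apply: orbit_refl.
  have: s i \in O by apply/orbitP; exists s; rewrite ?cycle_id.
  by rewrite Ox !inE => /eqP <-; rewrite eq_sym fixs (negPf ni).
have /subset_cardP/(_ sO) eqO : #|O| = #|[set~ i0]| by rewrite cardsC1 cT cO.
have : j \in O by rewrite eqO !inE.
by case/orbitP=> _ /cycleP[m ->] <-; exists m.
Qed.

(** Conjugating by h and powers of s moves i0 to any place, so H is doubly
    transitive; from one transposition one gets all those involving i0, then all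
    transpositions, which generate the symmetric group. *)
Lemma full_symmetric H s i0 a b h :
    s \in H -> (forall i j, i != i0 -> j != i0 -> exists m, (s ^+ m) i = j) ->
    s i0 = i0 -> h \in H -> h i0 != i0 ->
    tperm a b \in H -> a != b ->
  forall t, t \in H.
Proof.
move=> Hs trans_s fix_s Hh mv_h Hab nab.
have tJ x y g : g \in H -> tperm x y \in H -> tperm (g x) (g y) \in H.
  by move=> Hg Hxy; rewrite -tpermJ groupJ.
have fix_sm m : (s ^+ m) i0 = i0.
  by elim: m => [|m IHm]; rewrite ?perm1 // expgSr permM IHm.
have [c nc Hc] : exists2 c, c != i0 & tperm i0 c \in H.
  have [g Hg ga] : exists2 g, g \in H & g a = i0.
    have [->|na] := eqVneq a i0; first by exists 1; rewrite ?perm1.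
    have [m hm] := trans_s _ _ mv_h na.
    exists (h * s ^+ m)^-1; first by rewrite groupV groupM ?groupX.
    by apply: (@perm_inj _ (h * s ^+ m)); rewrite permKV permM.
  exists (g b); last by rewrite -ga tJ.
  by rewrite -ga (inj_eq perm_inj) eq_sym.
have Hi0 x : tperm i0 x \in H.
  have [->|nx] := eqVneq x i0; first by rewrite tperm1.
  have [m <-] := trans_s _ _ nc nx.
  by rewrite -(fix_sm m) tJ ?groupX.
have Hxy x y : tperm x y \in H.
  have [-> //|nx] := eqVneq x i0.
  have [->|ny] := eqVneq y i0; first by rewrite tpermC.
  have [->|nxy] := eqVneq x y; first by rewrite tperm1.
  have := tJ _ _ _ (Hi0 x) (Hi0 y).
  by rewrite tpermL tpermD // eq_sym.
move=> t; have [ts -> _] := prod_tpermP t.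
by rewrite group_prod.
Qed.

Lemma card_moved_tperm s :
  #|[set x | s x != x]| = 2 -> exists a b, a != b /\ s = tperm a b.
Proof.
move=> card2; have moved2 : #|[set x | s x != x]| <= 2 by rewrite card2.
have [a sa] : exists a, s a != a.
  have /card_gt0P[a] : 0 < #|[set x | s x != x]| by rewrite card2.
  by rewrite inE; exists a.
have mvD x : s x != x -> (x == a) || (x == s a).
  move=> sx; apply: contraLR moved2; rewrite negb_or -ltnNge => /andP[xa xsa].
  have <- : #|[set a; s a; x]| = 3.
    rewrite setUC cardsU1 !inE negb_or xa xsa cards2 /=.
    by rewrite eq_sym sa.
  apply: subset_leq_card; apply/subsetP => y; rewrite !inE -orbA.
  by case/or3P=> /eqP-> //; rewrite (inj_eq perm_inj).
have ssa : s (s a) = a.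
  have /orP[/eqP sse|/eqP/perm_inj sse] : (s (s a) == a) || (s (s a) == s a).
  - by apply: mvD; rewrite !(inj_eq perm_inj).
  - exact: sse.
  - by rewrite sse eqxx in sa.
exists a, (s a); split; first by rewrite eq_sym.
apply/permP => x; case: tpermP => [-> //|-> //|xa xsa].
by apply: contraTeq isT => /mvD/pred2P[].
Qed.

(** H meets the simple group Alt in a nontrivial normal subgroup. *)
Lemma normal_contains_Alt H s :
    5 <= #|T| -> (forall t, t \in 'N(H)) -> s \in H -> ~~ odd_perm s -> s != 1 ->
  'Alt_T \subset H.
Proof.
move=> T5 nH Hs even_s ns1.
have /simpleP[_ simA] := simple_Alt5 T5.
have nHA : (H :&: 'Alt_T)%G <| 'Alt_T.
  rewrite /normal subsetIr normsI ?normG //.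
  by apply/subsetP => t _; apply: nH.
have [e|e] := simA _ nHA.
  have: s \in (H :&: 'Alt_T)%G by rewrite inE Hs Alt_even.
  by rewrite e inE (negPf ns1).
by rewrite -e subsetIl.
Qed.
End Perm.

Section SumZero.
Variables (n q : nat).
Local Notation vect := {ffun 'I_n.+1 -> 'Z_q}.

(** Subtracting from v its image under the transposition of i and j leaves a
    multiple of e_i - e_j, as the other coordinates cancel, with the invertible
    factor v i - v j.  The permuted vectors e_a - e_b span all vectors of sum
    0. *)
Lemma perm_stable_sum_zero (V : vect -> Prop) (v : vect) i j :
    (forall c : 'Z_q, c != 0 -> exists m, c *+ m = 1) ->
    V 0 -> (forall u w, V u -> V w -> V (u + w)) -> (forall u, V u -> V (- u)) ->
    (forall (s : {perm 'I_n.+1}) u, V u -> V [ffun a => u (s a)]) ->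
    V v -> v i != v j ->
  forall u : vect, \sum_a u a = 0 -> V u.
Proof.
move=> inv V0 VD VN VJ Vv nvij.
have VX u m : V u -> V (u *+ m).
  by move=> Vu; elim: m => [|m IHm] //; rewrite mulrS; apply: VD.
pose e a b : vect := [ffun c => (c == a)%:R - (c == b)%:R].
have nij : i != j by apply: contraNneq nvij => ->.
have Vij : V (e i j).
  have [|m vm] := inv (v i - v j); first by rewrite subr_eq0.
  suff -> : e i j = (v - [ffun a => v (tperm i j a)]) *+ m.
    by apply/VX/VD => //; apply/VN/VJ.
  apply/ffunP => a; rewrite ffunMnE !ffunE.
  case: tpermP => [->|->|/eqP ai /eqP aj].
  - by rewrite eqxx vm (negPf nij) subr0.
  - by rewrite eqxx eq_sym (negPf nij) -(opprB (v i)) mulNrn vm sub0r.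
  by rewrite (negPf ai) (negPf aj) !subrr mul0rn.
have Vab a b : V (e a b).
  have [->|nab] := eqVneq a b.
    by have -> : e b b = 0 by apply/ffunP => c; rewrite !ffunE subrr.
  have [s [sa sb]] : exists s : {perm 'I_n.+1}, s a = i /\ s b = j.
    exists (tperm a i * tperm (tperm a i b) j)%g; rewrite !permM tpermL; split.
      rewrite (@tpermD _ _ _ i) // 1?eq_sym //; apply: contraNneq nab => /esym ib.
      by apply/eqP/(@perm_inj _ (tperm a i)); rewrite tpermL.
    by rewrite tpermL.
  suff -> : e a b = [ffun c => e i j (s c)] by apply: VJ.
  by apply/ffunP => c; rewrite !ffunE -sa -sb !(inj_eq perm_inj).
move=> u su.
have -> : u = \sum_a e a ord0 *+ (u a : nat).
  apply/ffunP => c; rewrite sum_ffunE.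
  under eq_bigr do rewrite ffunMnE ffunE mulrnBl.
  rewrite sumrB.
  have toZ a (x : 'Z_q) : x *+ (u a : nat) = x * u a.
    by rewrite -mulr_natr natr_Zp.
  under eq_bigr do rewrite toZ.
  under [X in _ - X]eq_bigr do rewrite toZ.
  rewrite -mulr_sumr su mulr0 subr0 (bigD1 c) //= eqxx mul1r big1 ?addr0 // => a.
  by rewrite eq_sym => /negPf ->; rewrite mul0r.
by elim/big_ind: _ => // a _; apply: VX.
Qed.
End SumZero.

Section Wr.
Local Open Scope nat_scope.
Local Open Scope group_scope.
Variables (n q : nat).
Local Notation W := (wreath ('Z_q) (perm_action 'I_n)).
Implicit Types (v : {ffun 'I_n -> 'Z_q}) (s : {perm 'I_n}) (w : W).

Definition translation v : W := (v, 1).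

Lemma translationD u v :
  (translation (u + v)%R = translation u * translation v).
Proof.
congr (_, _); last by rewrite mulg1.
by apply/ffunP => i; rewrite !ffunE act1.
Qed.

Lemma translation0 : translation 0%R = 1.
Proof. by congr (_, _); apply/ffunP => i; rewrite !ffunE. Qed.

Lemma translationN v : translation (- v)%R = (translation v)^-1.
Proof.
by apply/eqP; rewrite eq_mulgV1 invgK -translationD addNr translation0.
Qed.

(** Conjugation acts on the normal subgroup of vectors through the permutation
    of w alone, so a subgroup mapping onto the symmetric group acts on its
    vectors by all permutations. *)
Lemma translationJ w v :
  w * translation v * w^-1 = translation [ffun i => v (w.2 i)].
Proof.
apply: (mulIg w); rewrite mulgKV; case: w => a s /=; congr (_, _) => /=.
  apply/ffunP => i; rewrite !ffunE /= act1; apply: addrC.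
by rewrite mulg1 mul1g.
Qed.
End Wr.

Section Criterion.
Local Open Scope nat_scope.
Local Open Scope group_scope.
Variable H : {group cube_group}.

(** Modulo the vectors of sum 0, which are in H by [perm_stable_sum_zero], an
    element of the cube group is determined by its two permutations.  The edge permutations that H
    realizes with trivial corner permutation form a normal subgroup of S_12,
    containing an even permutation other than 1, hence all of A_12; two edge
    permutations that accompany the same corner permutation differ by an element
    of A_12. *)
Lemma rubik_criterion :
    H \subset rubik ->
    (forall s, exists2 h, h \in H & h.1.2 = s) ->
    (forall s, exists2 h, h \in H & h.2.2 = s) ->
    (exists h, [/\ h \in H, h.1.2 = 1 & h.2.2 != 1]) ->
    (exists v i j, ((translation v, 1) : cube_group) \in H /\ v i != v j) ->
    (exists v i j, ((1, translation v) : cube_group) \in H /\ v i != v j) ->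
  rubik \subset H.
Proof.
move=> sHR onto8 onto12 [h0 [Hh0 h01 h02]] [vx [ix [jx [Hvx nvx]]]]
  [vy [iy [jy [Hvy nvy]]]].
have even (h : cube_group) : h \in rubik -> odd_perm h.1.2 = odd_perm h.2.2.
  case: h => [[x r] [y s]]; rewrite in_rubik => /and3P[_ _] /=.
  by case: (odd_perm r); case: (odd_perm s).
have Vx (v : {ffun 'I_8 -> 'Z_3}) : (\sum_i v i = 0)%R -> ((translation v, 1) : cube_group) \in H.
  apply: (@perm_stable_sum_zero _ _ (fun v => ((translation v, 1) : cube_group) \in H)
            vx ix jx) => //.
  - move=> c nc; exists (val c).
    by case: c nc => [[|[|[|]]] ?] //= _; apply: val_inj.
  - by rewrite translation0 group1.
  - move=> u w Hu Hw; rewrite translationD.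
    have -> : ((translation u * translation w, 1) : cube_group)
      = (translation u, 1) * (translation w, 1) by congr (_, _); rewrite mulg1.
    exact: groupM.
  - move=> u Hu; rewrite translationN.
    have -> : (((translation u)^-1, 1) : cube_group)
      = (translation u, 1)^-1 by congr (_, _); rewrite invg1.
    by rewrite groupV.
  - move=> s u Hu; have [h Hh <-] := onto8 s.
    rewrite -translationJ.
    have -> : ((h.1 * translation u * h.1^-1, 1) : cube_group)
      = h * (translation u, 1) * h^-1 by congr (_, _); rewrite /= mulg1 mulgV.
    by rewrite !groupM ?groupV.
have Vy (y : {ffun 'I_12 -> 'Z_2}) : (\sum_i y i = 0)%R -> ((1, translation y) : cube_group) \in H.
  apply: (@perm_stable_sum_zero _ _ (fun v => ((1, translation v) : cube_group) \in H)
            vy iy jy) => //.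
  - move=> c nc; exists (val c).
    by case: c nc => [[|[|]] ?] //= _; apply: val_inj.
  - by rewrite translation0 group1.
  - move=> u w Hu Hw; rewrite translationD.
    have -> : ((1, translation u * translation w) : cube_group)
      = (1, translation u) * (1, translation w) by congr (_, _); rewrite mulg1.
    exact: groupM.
  - move=> u Hu; rewrite translationN.
    have -> : ((1, (translation u)^-1) : cube_group)
      = (1, translation u)^-1 by congr (_, _); rewrite invg1.
    by rewrite groupV.
  - move=> s u Hu; have [h Hh <-] := onto12 s.
    rewrite -translationJ.
    have -> : ((1, h.2 * translation u * h.2^-1) : cube_group)
      = h * (1, translation u) * h^-1 by congr (_, _); rewrite /= mulg1 mulgV.
    by rewrite !groupM ?groupV.
pose N2 := [set s | [exists h in H, (h.1.2 == 1) && (h.2.2 == s)]].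
have N2P s : reflect (exists h, [/\ h \in H, h.1.2 = 1 & h.2.2 = s]) (s \in N2).
  rewrite inE; apply: (iffP exists_inP).
    by case=> h Hh /andP[/eqP h1 /eqP h2]; exists h.
  by case=> h [Hh h1 h2]; exists h; rewrite // h1 h2 !eqxx.
have gN2 : group_set N2.
  apply/group_setP; split; first by apply/N2P; exists 1; rewrite group1.
  move=> s t /N2P[h [Hh h1 <-]] /N2P[k [Hk k1 <-]]; apply/N2P.
  by exists (h * k); rewrite groupM //= h1 k1 mulg1.
have AltN2 : 'Alt_('I_12) \subset group gN2.
  apply: (@normal_contains_Alt _ _ h0.2.2); rewrite ?card_ord //.
  - move=> t; rewrite inE; apply/subsetP => _ /imsetP[s /N2P[h [Hh h1 <-]] ->].
    have [k Hk <-] := onto12 t.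
    apply/N2P; exists (h ^ k); split; rewrite ?groupJ //.
    by rewrite /conjg /= h1 mul1g mulVg.
  - by apply/N2P; exists h0.
  - by rewrite -even ?(subsetP sHR) // h01 odd_perm1.
apply/subsetP => r Rr.
have [h [Hh h1 h2]] : exists h, [/\ h \in H, h.1.2 = r.1.2 & h.2.2 = r.2.2].
  have [h Hh h1] := onto8 r.1.2.
  have /(subsetP AltN2) : r.2.2 * h.2.2^-1 \in 'Alt_('I_12).
    rewrite Alt_even odd_permM odd_permV -even // -(even h) ?(subsetP sHR) //.
    by rewrite h1 addbb.
  case/N2P=> k [Hk k1 k2]; exists (k * h); split; first exact: groupM.
    by rewrite /= k1 mul1g.
  by rewrite /= k2 mulgKV.
suff : r * h^-1 \in H by rewrite groupMr ?groupV.
have : r * h^-1 \in rubik by apply: groupM => //; rewrite groupV; apply: (subsetP sHR).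
have : (r * h^-1).1.2 = 1 by rewrite /= h1 mulgV.
have : (r * h^-1).2.2 = 1 by rewrite /= h2 mulgV.
case: (r * h^-1) => [[x a] [y b]] /= -> ->; rewrite in_rubik.
case/and3P=> /eqP/Vx Hx /eqP/Vy Hy _.
suff -> : ((x, 1, (y, 1)) : cube_group) = (translation x, 1) * (1, translation y).
  exact: groupM.
by congr (_, _); rewrite /= ?mulg1 ?mul1g.
Qed.
End Criterion.

Section WreathPowers.
Variables (n q : nat).
Local Notation W := (wreath ('Z_q) (perm_action 'I_n)).
Implicit Types u : W.

Lemma wreath_expg2 u m : (u ^+ m)%g.2 = (u.2 ^+ m)%g.
Proof. by elim: m => // m IHm; rewrite !expgS /= IHm. Qed.

Lemma wreath_expg_fixed u m i : u.2 i = i -> (u ^+ m)%g.1 i = u.1 i *+ m.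
Proof.
move=> ui; elim: m => [|m IHm]; first by rewrite ffunE.
have mulE v : (u * v)%g.1 i = u.1 i + v.1 (u.2 i) by rewrite ffunE /= ffunE.
by rewrite expgS mulE ui IHm mulrS.
Qed.

Lemma wreath_expg_translation u m : u.2 = 1%g -> (u ^+ m)%g = translation (u.1 *+ m).
Proof.
move=> u1; rewrite [LHS]surjective_pairing wreath_expg2 u1 expg1n.
congr (_, _); apply/ffunP => i; rewrite ffunMnE.
by apply: wreath_expg_fixed; rewrite u1 perm1.
Qed.
End WreathPowers.

Lemma flip_double n (v : {ffun 'I_n -> 'Z_2}) : v *+ 2 = 0.
Proof.
apply/ffunP => i; rewrite ffunMnE ffunE.
by case: (v i) => [[|[|]] ?] //; apply: val_inj.
Qed.

Lemma twist_triple n (v : {ffun 'I_n -> 'Z_3}) : v *+ 3 = 0.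
Proof.
apply/ffunP => i; rewrite ffunMnE ffunE.
by case: (v i) => [[|[|[|]]] ?] //; apply: val_inj.
Qed.

Lemma expg_1_2 (c : cube_group) m : (c ^+ m)%g.1.2 = (c.1.2 ^+ m)%g.
Proof. by elim: m => // m IHm; rewrite !expgS /= IHm. Qed.

Lemma expg_2_2 (c : cube_group) m : (c ^+ m)%g.2.2 = (c.2.2 ^+ m)%g.
Proof. by elim: m => // m IHm; rewrite !expgS /= IHm. Qed.

Lemma expg_pair (c : cube_group) m : (c ^+ m)%g = ((c.1 ^+ m)%g, (c.2 ^+ m)%g).
Proof. by elim: m => // m IHm; rewrite !expgS IHm. Qed.

(** * Cyclic covers of a set of roots *)

(** The points over corner or edge i are the iterates of tau at a base point
    xi i; the orientation in 'Z_q is the number of iterations. *)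
Definition fiber_point (L : Type) (n q : nat) (tau : L -> L) (xi : 'I_n -> L)
  (u : 'I_n * 'Z_q) : L := iter (val u.2) tau (xi u.1).

Section Cover.
Variables (L : fieldType) (n q : nat) (tau kappa : L -> L) (X : seq L).
Hypotheses (q_gt1 : (1 < q)%N) (uX : uniq X) (sX : size X = (n * q)%N).
Hypothesis fiber : {in X &, forall x y, kappa x = kappa y -> y \in traject tau x q}.
Variable p : {poly L}.
Hypotheses (sp : size p = n.+1) (pX : {in X, forall x, root p (kappa x)}).

(** Counting: the values of kappa on X are among the at most n roots of p, and
    each is taken at most q times, by [fiber].  As X has n q elements, both
    bounds are attained: p splits into the values of kappa, and each fibre is a
    full orbit of tau. *)
Lemma cover_structure : exists xi : 'I_n -> L,
  [/\ injective (@fiber_point L n q tau xi),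
      forall x, x \in X <-> exists u : 'I_n * 'Z_q, x = fiber_point tau xi u,
      injective (kappa \o xi) &
      p = lead_coef p *: \prod_i ('X - (kappa (xi i))%:P)].
Proof.
have q_gt0 : (0 < q)%N by apply: ltnW.
pose T := undup (map kappa X).
have TX t : (t \in T) = (t \in map kappa X) by rewrite mem_undup.
have rootT : all (root p) T.
  by apply/allP => t; rewrite TX => /mapP[x /pX rx ->].
have nzp : p != 0 by rewrite -size_poly_eq0 sp.
have leTn : (size T <= n)%N.
  by rewrite -ltnS -sp; apply: max_poly_roots => //; apply: undup_uniq.
pose fib t := [seq x <- X | kappa x == t].
have fib_small t : (size (fib t) <= q)%N.
  case Ef: (fib t) => [|x s] //; rewrite -Ef -(size_traject tau x q).
  apply: uniq_leq_size; first exact: filter_uniq.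
  have: x \in fib t by rewrite Ef mem_head.
  rewrite mem_filter => /andP[/eqP kx xX] y; rewrite mem_filter => /andP[/eqP ky yX].
  by apply: fiber; rewrite // kx ky.
have geTn : (n <= size T)%N.
  rewrite -(leq_pmul2r q_gt0) -sX.
  have -> : (size T * q = sumn [seq q | t <- T])%N.
    by elim: (T) => //= _ s IHs; rewrite mulSn IHs.
  apply: (@leq_trans (sumn [seq size (fib t) | t <- T])).
    rewrite -[map _ _]/(map (size \o fib) T) map_comp -[map size _]/(shape _) -size_flatten.
    apply: uniq_leq_size => // x xX; apply/flattenP.
    exists (fib (kappa x)); first by rewrite map_f // TX map_f.
    by rewrite mem_filter eqxx.
  by elim: (T) => //= t s IHs; rewrite leq_add.
have sT : size T = n by apply/eqP; rewrite eqn_leq leTn.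
have xi_ex (i : 'I_n) : exists x, (x \in X) && (kappa x == nth 0 T i).
  have : nth 0 T i \in T by rewrite mem_nth // sT.
  by rewrite TX => /mapP[x xX ->]; exists x; rewrite xX eqxx.
pose xi i := xchoose (xi_ex i).
have xiX i : xi i \in X by have /andP[] := xchooseP (xi_ex i).
have kxi i : kappa (xi i) = nth 0 T i by have /andP[_ /eqP] := xchooseP (xi_ex i).
pose pt := @fiber_point L n q tau xi.
have subX : {subset X <= codom pt}.
  move=> x xX.
  have /(nthP 0)[i ltiT kx] : kappa x \in T by rewrite TX map_f.
  rewrite sT in ltiT; have := @fiber (xi (Ordinal ltiT)) x (xiX _) xX.
  rewrite kxi kx => /(_ erefl)/trajectP[e lte ->].
  have lte' : (e < (Zp_trunc q).+2)%N by rewrite Zp_cast.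
  by apply/codomP; exists (Ordinal ltiT, Ordinal lte').
have s_cod : size (codom pt) = size X.
  by rewrite size_codom card_prod !card_ord sX Zp_cast.
have u_cod : uniq (codom pt) by apply: leq_size_uniq uX subX _; rewrite s_cod.
have eqX : X =i codom pt by have [] := uniq_min_size uX subX; rewrite ?s_cod.
exists xi; split.
- exact/injectiveP.
- by move=> x; rewrite eqX; split=> [/codomP|[u ->]]; last exact: codom_f.
- move=> i j /=; rewrite !kxi => /eqP.
  by rewrite nth_uniq ?sT ?undup_uniq // => /eqP/val_inj.
rewrite (@all_roots_prod_XsubC _ p T) ?sT //; last first.
  by rewrite uniq_rootsE undup_uniq.
rewrite lead_coefZ (monicP (monic_prod_XsubC _ _ _)) mulr1; congr (_ *: _).
rewrite (big_nth 0) sT big_mkord.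
by apply: eq_bigr => i _; rewrite kxi.
Qed.
End Cover.

Section WreathAction.
Variables (L : splittingFieldType rat) (n q : nat) (tau : L -> L) (xi : 'I_n -> L).
Hypothesis q_gt1 : (1 < q)%N.

Local Notation point := (@fiber_point L n q tau xi).
Hypothesis point_inj : injective point.
Hypothesis tau_order : forall i, iter q tau (xi i) = xi i.
Hypothesis gal_tau : forall (s : gal_of {:L}) x, s (tau x) = tau (s x).
Hypothesis gal_xi : forall (s : gal_of {:L}) i, exists u, s (xi i) = point u.

Lemma iter_fiber_point i (c e : 'Z_q) :
  iter (val e) tau (point (i, c)) = point (i, c + e).
Proof.
have valD : val (c + e) = ((val c + val e) %% q)%N.
  by congr (_ %% _)%N; exact: Zp_cast.
rewrite /fiber_point valD -iterD; move: (val c) (val e) => a b /=.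
rewrite addnC [in LHS](divn_eq (a + b) q) addnC iterD; congr (iter _ _ _).
by elim: (_ %/ _)%N => //= m IHm; rewrite mulSn iterD IHm tau_order.
Qed.

Lemma gal_iter_tau (s : gal_of {:L}) m x : s (iter m tau x) = iter m tau (s x).
Proof. by elim: m => //= m IHm; rewrite gal_tau IHm. Qed.

(** An automorphism is known on the base points, hence everywhere as it commutes
    with tau.  Automorphisms and permutations both compose from left to right
    in their groups, so the product obtained is that of the wreath
    product. *)
Lemma wreath_action : exists Phi : gal_of {:L} -> wreath ('Z_q) (perm_action 'I_n),
  (forall (s : gal_of {:L}) i (e : 'Z_q), s (point (i, e))
     = point ((Phi s).2 i, (Phi s).1 i + e)) /\
  {morph Phi : s t / (s * t)%g}.
Proof.
have loc_ex (s : gal_of {:L}) i : {u | s (xi i) = point u}.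
  by apply: sig_eqW; have [u ->] := gal_xi s i; exists u.
pose loc s i := sval (loc_ex s i).
have locE (s : gal_of {:L}) i (e : 'Z_q) : s (point (i, e))
    = point ((loc s i).1, (loc s i).2 + e).
  rewrite -iter_fiber_point -surjective_pairing -(svalP (loc_ex s i)).
  by rewrite /fiber_point gal_iter_tau.
have rho_inj s : injective (fun i => (loc s i).1).
  move=> i j eij; pose e := (loc s j).2 - (loc s i).2.
  have: s (point (i, e)) = s (point (j, 0)).
    by rewrite !locE eij addr0 addrC subrK.
  by move/fmorph_inj/point_inj => -[].
pose Phi (s : gal_of {:L}) : wreath ('Z_q) (perm_action 'I_n) :=
  ([ffun i => (loc s i).2], perm (@rho_inj s)).
have PhiE (s : gal_of {:L}) i (e : 'Z_q) : s (point (i, e))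
     = point ((Phi s).2 i, (Phi s).1 i + e).
  by rewrite /= permE ffunE locE.
clearbody Phi; exists Phi; split=> // s t.
have key i : (((Phi (s * t)%g).2 i, (Phi (s * t)%g).1 i) : 'I_n * 'Z_q)
    = ((Phi t).2 ((Phi s).2 i), (Phi s).1 i + (Phi t).1 ((Phi s).2 i)).
  apply: point_inj; rewrite -[(Phi (s * t)%g).1 i]addr0 -PhiE galM ?memvf //.
  by rewrite !PhiE addr0 addrC.
rewrite [LHS]surjective_pairing; congr (_, _).
  by apply/ffunP => i; have [_ ->] := key i; rewrite !ffunE.
by apply/permP => i; have [->] := key i; rewrite permM.
Qed.
End WreathAction.

(** * The roots of f and g *)

Section RootsOfFG.
Variable L : splittingFieldType rat.
Local Notation inL := (map_poly (in_alg L)).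

Lemma algint_root a (x : L) : ev (monicZ a) x = 0 ->
  exists2 y : algint L, val y = x & ev (monicZ a) y = 0.
Proof.
move=> ax; have [y yx] := algint_lift (integral_ev ax); exists y => //.
by apply: val_inj; rewrite [LHS](rmorph_ev (val : algint L -> L)) [_ y]yx ax.
Qed.

(** A multiple root, being an algebraic integer, would reduce to a multiple root
    in a residue field of characteristic P. *)
Lemma separable_mod (P : positive) a u v (x : L) : prime (Pos.to_nat P) ->
  sep_cert P a u v -> ev (monicZ a) x = 0 -> ev (pderiv (monicZ a)) x <> 0.
Proof.
move=> prP cert ax; have [y <-{x ax} ay] := algint_root ax.
rewrite -(rmorph_ev (val : algint L -> L)) -[0](rmorph0 (val : algint L -> L)).
move/val_inj => a'y.
have [w|k [phi phiP]] := @residue_field (algint L) (Pos.to_nat P)%:R.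
  exact: algint_prime_nonunit.
have P0 : zr k (Zpos P) = 0 by rewrite zr_pos -phiP rmorph_nat.
by apply: (sep_certP P0 cert (x := phi y)); rewrite -rmorph_ev ?ay ?a'y rmorph0.
Qed.

Lemma split_dvdp (p : {poly L}) rs :
    p \is monic -> p %| \prod_(r <- rs) ('X - r%:P) ->
  exists ps, p = \prod_(r <- ps) ('X - r%:P).
Proof.
move=> p_monic /dvdp_prod_XsubC[m pE]; exists (mask m rs).
by apply/eqP; rewrite -eqp_monic ?monic_prod_XsubC.
Qed.

Lemma in_alg_binQ (P : positive) : in_alg L (binQ (Npos P)) = zr L (Zpos P).
Proof.
rewrite /binQ rmorph_nat zr_pos; congr _%:R; lia.
Qed.

Lemma map_monomial P n :
  inL (binQ (Npos P) *: 'X^n) = zr {poly L} (Zpos P) * 'X^n.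
Proof.
by rewrite map_polyZ map_polyXn [_ (binQ _)]in_alg_binQ -mul_polyC (rmorph_zr polyC).
Qed.

Lemma f_polyE : inL f_poly = ev (monicZ f_low) 'X.
Proof.
have hD p q : inL (p + q) = inL p + inL q by rewrite rmorphD.
have hN p : inL (- p) = - inL p by rewrite rmorphN.
have h_lin : inL 1 = 1 by rewrite rmorph1.
rewrite /f_poly -[X in _ - _ *: X + 1]expr1 !(hD, hN, h_lin) !map_monomial map_polyXn.
rewrite /= !zr_neg zr0 zr1.
ring.
Qed.

(** kappa3 x is the parameter c of the simplest cubic X^3 - cX^2 + (c - 3)X + 1
    with root x, and tau3 permutes its roots cyclically. *)
Definition kappa3 (x : L) : L := (x ^+ 3 - 3%:R * x + 1) / (x ^+ 2 - x).
Definition tau3 (x : L) : L := (1 - x)^-1.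

Lemma f_root_kappa x : ev (monicZ f_low) x = 0 ->
  [/\ x != 0, x != 1 & ev (monicZ p_low) (kappa3 x) = 0].
Proof.
rewrite (ev_eq x f_of_p) ev_add ev_pow ev_add ev_scale ev_mul ev_pow ev_scale ev_pow.
have -> : ev kappa_num x = x ^+ 3 - 3%:R * x + 1.
  rewrite /= zr0 zr1 zr_neg (zr_pos _ 3) -[Pos.to_nat 3]/3%N; ring.
have -> : ev kappa_den x = x ^+ 2 - x by rewrite /= zr0 zr1 zr_neg zr1; ring.
set N := (X in X ^+ 8); set D := x ^+ 2 - x => fx.
have D0 : D != 0.
  apply/eqP => D0; move: fx.
  rewrite D0 !expr0n /= !mulr0 !addr0 => /eqP; rewrite expf_eq0 /= => /eqP N0.
  have /eqP : x * (x - 1) = 0 by rewrite -D0 /D; ring.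
  rewrite mulf_eq0 subr_eq0 => /orP[] /eqP x01.
    by move/eqP: N0; rewrite /N x01 expr0n mulr0 subr0 add0r oner_eq0.
  move/eqP: N0; rewrite /N x01 expr1n mulr1.
  have -> : (1 - 3%:R + 1 : L) = - 1 by ring.
  by rewrite oppr_eq0 oner_eq0.
split.
- by apply: contraNneq D0 => x0; rewrite /D x0 expr0n subrr.
- by apply: contraNneq D0 => x1; rewrite /D x1 expr1n subrr.
apply: (mulIf (expf_neq0 8 D0)); rewrite mul0r -fx.
rewrite /= zr0 zr1 -/N -/D /kappa3 -/N -/D.
by field.
Qed.

Lemma kappa3_den_neq0 x : x != 0 -> x != 1 -> x ^+ 2 - x != 0 :> L.
Proof.
move=> x0 x1; have -> : x ^+ 2 - x = x * (x - 1) by ring.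
by rewrite mulf_neq0 // subr_eq0.
Qed.

(** The difference of the cross products factors as
    (y - x)(y(1 - x) - 1)(yx - x + 1), with roots y = x, tau x, tau (tau x). *)
Lemma kappa3_fiber x y : x != 0 -> x != 1 -> y != 0 -> y != 1 ->
  kappa3 x = kappa3 y -> y \in traject tau3 x 3.
Proof.
move=> x0 x1 y0 y1 /eqP; rewrite /kappa3 eqr_div ?kappa3_den_neq0 // -subr_eq0.
have -> : (x ^+ 3 - 3%:R * x + 1) * (y ^+ 2 - y) - (y ^+ 3 - 3%:R * y + 1) * (x ^+ 2 - x)
   = (y - x) * ((y * (1 - x) - 1) * (y * x - x + 1)) by ring.
have x1' : 1 - x != 0 by rewrite subr_eq0 eq_sym.
rewrite !mulf_eq0 !subr_eq0 /= !inE /tau3 => /or3P[-> //|/eqP e|/eqP e].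
  by apply/or3P/Or32/eqP/(mulIf x1'); rewrite e mulVf.
apply/or3P/Or33/eqP.
have -> : y = (x - 1) / x.
  apply: (mulIf x0); rewrite divfK //.
  by apply/eqP; rewrite -subr_eq0 opprB addrA addrAC e.
have -> : 1 - (1 - x)^-1 = x / (x - 1) by field; rewrite x1' subr_eq0 x1.
by rewrite invf_div.
Qed.

Lemma tau3_order x : x != 0 -> x != 1 -> tau3 (tau3 (tau3 x)) = x.
Proof.
move=> x0 x1; rewrite /tau3.
have x1' : x - 1 != 0 by rewrite subr_eq0.
have x2' : 1 - x != 0 by rewrite subr_eq0 eq_sym.
have -> : 1 - (1 - x)^-1 = x / (x - 1) by field; rewrite x1' x2'.
rewrite invf_div; have -> : 1 - (x - 1) / x = x^-1 by field.
exact: invrK.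
Qed.

Lemma prime233 : prime (Pos.to_nat 233). Proof. by vm_compute. Qed.

Lemma f_cover rs : inL f_poly %| \prod_(r <- rs) ('X - r%:P) ->
  exists xi : 'I_8 -> L,
  [/\ injective (@fiber_point L 8 3 tau3 xi),
      forall x, root (inL f_poly) x <->
        exists u : 'I_8 * 'Z_3, x = fiber_point tau3 xi u,
      injective (kappa3 \o xi) &
      ev (monicZ p_low) 'X = \prod_i ('X - (kappa3 (xi i))%:P)].
Proof.
rewrite f_polyE => /(split_dvdp (ev_monic_monic _ _))[X fX].
have fx x : x \in X -> ev (monicZ f_low) x = 0.
  by rewrite -horner_ev fX => Xx; apply/eqP; rewrite -/(root _ _) root_prod_XsubC.
have uX : uniq X.
  apply: uniq_simple_roots fX _ => x; rewrite deriv_ev !horner_ev.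
  exact: separable_mod prime233 f_233_separable.
have sX : size X = (8 * 3)%N.
  by apply/eqP; rewrite -eqSS -(size_prod_XsubC X id) -fX size_ev_monic.
have fib : {in X &, forall x y, kappa3 x = kappa3 y -> y \in traject tau3 x 3}.
  move=> x y /fx/f_root_kappa[x0 x1 _] /fx/f_root_kappa[y0 y1 _].
  exact: kappa3_fiber.
have [||xi [ptinj Xpt kinj pE]] := cover_structure _ uX sX fib
    (size_ev_monic _ p_low) _ => //.
  by move=> x /fx/f_root_kappa[_ _ px]; rewrite /root horner_ev px.
exists xi; split=> //.
  by move=> x; rewrite fX root_prod_XsubC.
by rewrite [LHS]pE (monicP (ev_monic_monic _ _)) scale1r.
Qed.

Local Notation num := (zr L sqrt_num).
Local Notation den := (zr L sqrt_den).

Lemma zr_neq0 c : c != Z0 -> zr L c != 0.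
Proof.
move=> c0; rewrite zrE -(rmorph_int (in_alg L)) fmorph_eq0 intr_eq0.
by apply: contraNneq c0 => c0; rewrite -[c]int_of_ZK c0.
Qed.

Lemma den_neq0 : den != 0.
Proof. exact: zr_neq0. Qed.

Lemma h_eval y : ev (monicZ h_low) y
  = y ^+ 12 + num ^+ 2 * den ^+ 20 * y + num ^+ 2 * den ^+ 22.
Proof.
rewrite ev_monic_trinomial.
have -> : zr L h_lin = num ^+ 2 * den ^+ 20 by rewrite /h_lin zrM !zr_exp.
by have -> : zr L h_const = num ^+ 2 * den ^+ 22 by rewrite /h_const zrM !zr_exp.
Qed.

Lemma map_g_shape P Q : inL ('X^24 + (binQ (Npos P) / binQ (Npos Q)) *: ('X^2 + 1))
  = 'X^24 + (zr L (Zpos P) / zr L (Zpos Q)) *: ('X^2 + 1).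
Proof.
rewrite rmorphD /= map_polyXn map_polyZ rmorphD /= map_polyXn rmorph1.
by rewrite -!in_alg_binQ -fmorph_div.
Qed.

Lemma g_polyE : inL g_poly = 'X^24 + ((num / den) ^+ 2) *: ('X^2 + 1).
Proof.
rewrite /g_poly map_g_shape.
have -> : 3852443469645611961262219752967766016%ZZ = (sqrt_num ^ 2)%ZZ by vm_compute.
have -> : 384257037754753807138505851908147025%ZZ = (sqrt_den ^ 2)%ZZ by vm_compute.
by rewrite !zr_exp expr_div_n.
Qed.

(** Clears denominators: den x is a root of an integer monic polynomial. *)
Lemma g_scale x : ev (monicZ g_low) (den * x) = den ^+ 24 * (inL g_poly).[x].
Proof.
rewrite /g_low ev_monic_double h_eval g_polyE hornerD hornerZ hornerD hornerC !hornerXn.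
have := den_neq0; set d := den; set m := num => d0; by field.
Qed.

Lemma g_scale_deriv x :
  ev (pderiv (monicZ g_low)) (den * x) = den ^+ 23 * (inL g_poly)^`().[x].
Proof.
have zh1 : zr L h_lin = num ^+ 2 * den ^+ 20 by rewrite /h_lin zrM !zr_exp.
rewrite -horner_ev -deriv_ev ev_monic_double ev_monic_trinomial -exprM g_polyE.
rewrite -!(rmorph_zr polyC) /= zh1 !mul_polyC !derivD !derivZ !derivD !derivC !derivXn.
rewrite !addr0 !hornerD !hornerZ !hornerMn !hornerXn /=.
have := den_neq0; set d := den; set m := num => d0; by field.
Qed.

Lemma g_cover rs : inL g_poly %| \prod_(r <- rs) ('X - r%:P) ->
  exists w : 'I_12 -> L,
  [/\ injective (@fiber_point L 12 2 -%R w),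
      forall x, root (inL g_poly) x <->
        exists u : 'I_12 * 'Z_2, den * x = fiber_point -%R w u,
      injective (fun i => w i ^+ 2) &
      ev (monicZ h_low) 'X = \prod_i ('X - (w i ^+ 2)%:P)].
Proof.
have s_X2 : (size ('X^2 + 1 : {poly L})%R <= 24)%N by rewrite -[1]/(1%:P) size_XnaddC.
have g_monic : inL g_poly \is monic.
  rewrite g_polyE qualifE /= lead_coefDl ?lead_coefXn // size_polyXn ltnS.
  exact: leq_trans (size_scale_leq _ _) s_X2.
have s_g : size (inL g_poly) = 25%N.
  rewrite g_polyE size_polyDl ?size_polyXn // ltnS.
  exact: leq_trans (size_scale_leq _ _) s_X2.
move=> /(split_dvdp g_monic)[ws gX].
have gw x : x \in ws -> ev (monicZ g_low) (den * x) = 0.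
  rewrite g_scale gX => Xx; apply/eqP; rewrite mulf_eq0; apply/orP; right.
  by rewrite -/(root _ _) root_prod_XsubC.
have uws : uniq ws.
  apply: uniq_simple_roots gX _ => x gx0 g'x0.
  apply: (separable_mod prime233 g_233_separable (x := den * x)).
    by rewrite g_scale gx0 mulr0.
  by rewrite g_scale_deriv g'x0 mulr0.
pose X := [seq den * x | x <- ws].
have uX : uniq X by rewrite map_inj_uniq //; apply: mulfI den_neq0.
have sX : size X = (12 * 2)%N.
  by apply/eqP; rewrite size_map -eqSS -(size_prod_XsubC ws id) -gX s_g.
have fib : {in X &, forall x y, x ^+ 2 = y ^+ 2 -> y \in traject -%R x 2}.
  by move=> x y _ _ /eqP; rewrite eq_sym eqf_sqr !inE.
have [||w [ptinj Xpt kinj pE]] := cover_structure _ uX sX fib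
    (size_ev_monic _ h_low) _ => //.
  move=> _ /mapP[x /gw gx ->]; rewrite /root horner_ev -gx.
  by rewrite /g_low ev_monic_double.
exists w; split=> //.
  by move=> x; rewrite gX root_prod_XsubC -Xpt (mem_map (mulfI den_neq0)).
by rewrite [LHS]pE (monicP (ev_monic_monic _ _)) scale1r.
Qed.
End RootsOfFG.

(** * The vanishing of the three invariants *)

Section Eisenstein.
Variable K : fieldType.
(** The ring K[theta] with theta^2 = theta - 1, the pair (a, b) standing for
    a + b theta.  It need not be a field: K may already contain a sixth root of
    unity.  Working with formal pairs makes automorphisms of K act while fixing
    theta. *)
Definition eis : Type := (K * K)%type.
HB.instance Definition _ := GRing.Zmodule.on eis.
Definition eis_one : eis := (1, 0).
Definition eis_mul (u v : eis) : eis :=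
  (u.1 * v.1 - u.2 * v.2, u.1 * v.2 + u.2 * v.1 + u.2 * v.2).
Fact eis_mulA : associative eis_mul.
Proof. by move=> [a b] [c d] [e f]; congr (_, _) => /=; ring. Qed.
Fact eis_mulC : commutative eis_mul.
Proof. by move=> [a b] [c d]; congr (_, _) => /=; ring. Qed.
Fact eis_mul1 : left_id eis_one eis_mul.
Proof. by move=> [a b]; congr (_, _) => /=; ring. Qed.
Fact eis_mulD : left_distributive eis_mul +%R.
Proof. by move=> [a b] [c d] [e f]; congr (_, _) => /=; ring. Qed.
Fact eis_one_neq0 : eis_one != 0.
Proof. by rewrite xpair_eqE oner_eq0. Qed.
HB.instance Definition _ := GRing.Zmodule_isComNzRing.Build eis
  eis_mulA eis_mulC eis_mul1 eis_mulD eis_one_neq0.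

Definition eisC (a : K) : eis := (a, 0).
Fact eisC_is_zmod_morphism : zmod_morphism eisC.
Proof. by move=> a b; congr (_, _); rewrite /= subr0. Qed.
HB.instance Definition _ :=
  GRing.isZmodMorphism.Build K eis eisC eisC_is_zmod_morphism.
Fact eisC_is_monoid_morphism : monoid_morphism eisC.
Proof. by split=> [|a b] //; congr (_, _) => /=; ring. Qed.
HB.instance Definition _ :=
  GRing.isMonoidMorphism.Build K eis eisC eisC_is_monoid_morphism.

Definition theta : eis := (0, 1).
Lemma theta3 : theta ^+ 3 = - 1.
Proof. by rewrite !exprS expr0; congr (_, _) => /=; ring. Qed.

(** 1, theta and theta^2 = theta - 1 are pairwise not proportional over K, while
    theta^3 = -1. *)
Lemma eis_theta_power (l : K) (u : eis) n :
  l != 0 -> eisC l * theta ^+ n = u -> u.2 = 0 -> (n %% 3 = 0)%N.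
Proof.
move=> l0 <-; rewrite {1}(divn_eq n 3) exprD mulnC exprM theta3.
rewrite -[(-1) ^+ _](rmorph_sign eisC) mulrA -rmorphM.
set m := l * _; have m0 : m != 0 by rewrite mulf_neq0 ?signr_eq0.
case: (n %% 3)%N (ltn_pmod n (isT : 0 < 3)%N) => [|[|[|]]] // _.
  by move=> /= e; case/eqP: m0; rewrite -[RHS]e; ring.
by rewrite expr2 => /= e; case/eqP: m0; rewrite -[RHS]e; ring.
Qed.

(** The theta-coordinate of (a + b theta)^3 is 3ab(a + b), and a = 0, b = 0,
    a = -b give multiples of theta, 1 and theta^2. *)
Lemma eis_cube_scalar (u : eis) : (u ^+ 3).2 = 0 -> 3%:R != 0 :> K ->
  exists l n, u = eisC l * theta ^+ n.
Proof.
case: u => a b; rewrite !exprS expr0 /= => e n3.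
have /eqP : 3%:R * (a * (b * (a + b))) = 0 by rewrite -[RHS]e; ring.
rewrite !mulf_eq0 (negPf n3) /= => /or3P[] /eqP e0.
- by exists b, 1%N; rewrite e0; congr (_, _) => /=; ring.
- by exists a, 0%N; rewrite e0; congr (_, _) => /=; ring.
exists b, 2%N; rewrite (_ : a = - b); last by apply/eqP; rewrite -addr_eq0 e0.
by rewrite expr2; congr (_, _) => /=; ring.
Qed.

(** In characteristic prime to 3, this identity exhibits Shanks' cubic as a
    Kummer extension after theta is adjoined. *)
Lemma eis_sub_cube (x : K) : x ^+ 2 - x != 0 ->
  (eisC x - theta) ^+ 3 =
  eisC (x ^+ 2 - x) * (eisC ((x ^+ 3 - 3%:R * x + 1) / (x ^+ 2 - x)) - 3%:R * theta).
Proof.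
move=> D0; rewrite mulrBr -rmorphM mulrCA divff // mulr1.
have -> : 3%:R * theta = eisC 3%:R * theta by rewrite rmorph_nat.
by rewrite !exprS expr0; congr (_, _) => /=; ring.
Qed.

(** tau is the Moebius transformation fixing theta and its conjugate. *)
Lemma eis_tau (x : K) : 1 - x != 0 ->
  eisC (1 - x)^-1 - theta = eisC (1 - x)^-1 * theta * (eisC x - theta).
Proof. by move=> x1; congr (_, _) => /=; field. Qed.

(** As theta^8 = theta - 1, both sides are 144 theta - 72: this is what the
    coefficients of p are chosen for. *)
Lemma eis_p : ev (monicZ p_low) (3%:R * theta) = eisC 24%:R * (1 + theta) ^+ 3.
Proof.
rewrite ev_monic_trinomial rmorph_nat.
have -> : 3%:R = zr eis 3 by rewrite zr_pos.
have -> : 24%:R = zr eis 24 by rewrite zr_pos.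
have e1 : zr eis (-2139) * zr eis 3 = zr eis 24 * zr eis 6 - zr eis 3 ^+ 8.
  by rewrite -(zr_exp _ 3 8) -!zrM -zrN -zrD.
have e2 : zr eis 6489 = zr eis 3 ^+ 8 - zr eis 24 * zr eis 3.
  by rewrite -(zr_exp _ 3 8) -!zrM -zrN -zrD.
have e6 : zr eis 6 = 6%:R by rewrite zr_pos.
have e3 : zr eis 3 = 3%:R by rewrite zr_pos.
rewrite mulrA e1 e2 e6 exprMn; set z := _ ^+ 8; rewrite e3.
have -> : theta ^+ 8 = theta ^+ 2.
  by rewrite (exprD _ 6 2) (exprM _ 3 2) theta3 sqrrN expr1n mul1r.
have -> : theta ^+ 2 = theta - 1 by rewrite expr2; congr (_, _) => /=; ring.
have -> : (1 + theta) ^+ 3 = 6%:R * theta - 3%:R.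
  have -> : (1 + theta) ^+ 3 = 1 + 3%:R * theta + 3%:R * theta ^+ 2 + theta ^+ 3 by ring.
  rewrite theta3; have -> : theta ^+ 2 = theta - 1 by rewrite expr2; congr (_, _) => /=; ring.
  ring.
ring.
Qed.
End Eisenstein.

Section EisMap.
Variables (K : fieldType) (s : {rmorphism K -> K}).
Definition eis_map (u : eis K) : eis K := (s u.1, s u.2).
Fact eis_map_is_zmod_morphism : zmod_morphism eis_map.
Proof. by move=> [a b] [c d]; congr (_, _); rewrite /= rmorphB. Qed.
HB.instance Definition _ :=
  GRing.isZmodMorphism.Build (eis K) (eis K) eis_map eis_map_is_zmod_morphism.
Fact eis_map_is_monoid_morphism : monoid_morphism eis_map.
Proof.
split=> [|[a b] [c d]]; congr (_, _); rewrite /= ?rmorph0 ?rmorph1 //.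
  by rewrite rmorphB !rmorphM.
by rewrite !rmorphD !rmorphM.
Qed.
HB.instance Definition _ :=
  GRing.isMonoidMorphism.Build (eis K) (eis K) eis_map eis_map_is_monoid_morphism.
End EisMap.

Section SumX.
Variable L : splittingFieldType rat.
Implicit Type x : L.

Lemma natr_neq0 n : n != 0%N -> n%:R != 0 :> L.
Proof. by move=> n0; rewrite -(rmorph_nat (in_alg L)) fmorph_eq0 pnatr_eq0. Qed.

Lemma tau3_good x : x != 0 -> x != 1 -> tau3 x != 0 /\ tau3 x != 1.
Proof.
move=> x0 x1; have x1' : 1 - x != 0 by rewrite subr_eq0 eq_sym.
split; first by rewrite invr_eq0.
by rewrite invr_eq1 -subr_eq0 addrAC subrr sub0r oppr_eq0.
Qed.

Lemma eis_iter_tau x m : x != 0 -> x != 1 ->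
  exists2 l, l != 0 & eisC (iter m (@tau3 L) x) - theta L
    = eisC l * theta L ^+ m * (eisC x - theta L).
Proof.
move=> x0 x1; suff [_ [_ []]] : iter m (@tau3 L) x != 0 /\ iter m (@tau3 L) x != 1 /\
  exists2 l, l != 0 & eisC (iter m (@tau3 L) x) - theta L
    = eisC l * theta L ^+ m * (eisC x - theta L) by move=> l; exists l.
elim: m => [|m [y0 [y1 [l l0 IHm]]]].
  by split=> //; split=> //; exists 1; rewrite ?oner_neq0 // rmorph1 !mul1r.
have [t0 t1] := tau3_good y0 y1; split=> //; split=> //.
have y1' : 1 - iter m (@tau3 L) x != 0 by rewrite subr_eq0 eq_sym.
exists ((1 - iter m (@tau3 L) x)^-1 * l); first by rewrite mulf_neq0 ?invr_eq0.
rewrite /= eis_tau // IHm rmorphM exprS.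
by rewrite !mulrA; congr (_ * _); rewrite -!mulrA; congr (_ * _); rewrite mulrCA.
Qed.

(** Let U be the product of the xi i - theta.  By [eis_sub_cube] and [eis_p],
    U^3 is a scalar times (1 + theta)^3, and (1 + theta)(2 - theta) = 3, so
    W = U (2 - theta) has a scalar cube; by [eis_cube_scalar], W is a scalar l
    times a power of theta.  By [eis_tau], s multiplies W by a scalar times
    theta^S, where S is the sum of the twists; since s fixes theta, comparing
    with s l shows that theta^S is a scalar. *)
Lemma sum_x_eq0 (xi : 'I_8 -> L) (s : gal_of {:L}) (rho : {perm 'I_8}) (e : 'I_8 -> 'Z_3) :
    (forall i, xi i != 0 /\ xi i != 1) ->
    (forall i, s (xi i) = iter (val (e i)) (@tau3 L) (xi (rho i))) ->
    ev (monicZ p_low) 'X = \prod_i ('X - (kappa3 (xi i))%:P) ->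
  \sum_i e i = 0.
Proof.
move=> xi_good s_xi pE.
pose th := theta L.
pose U := \prod_i (eisC (xi i) - th).
pose S := (\sum_i val (e i))%N.
have xiD i : xi i ^+ 2 - xi i != 0 by have [? ?] := xi_good i; apply: kappa3_den_neq0.
have [lam lam0 sU] : exists2 l, l != 0 & eis_map s U = eisC l * th ^+ S * U.
  have lam_ex i : {l | (l != 0) && (eisC (s (xi i)) - th
      == eisC l * th ^+ val (e i) * (eisC (xi (rho i)) - th))}.
    apply: sigW; have [x0 x1] := xi_good (rho i).
    by have [l l0 lE] := eis_iter_tau (val (e i)) x0 x1; exists l; rewrite l0 s_xi lE eqxx.
  exists (\prod_i sval (lam_ex i)).
    by apply/prodf_neq0 => i _; have /andP[] := svalP (lam_ex i).
  have UE : U = \prod_i (eisC (xi (rho i)) - th).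
    by rewrite [LHS](reindex_inj (@perm_inj _ rho)).
  rewrite [in RHS]UE rmorph_prod /= rmorph_prod -prodrXr -!big_split /=.
  apply: eq_bigr => i _; have /andP[_ /eqP <-] := svalP (lam_ex i).
  rewrite rmorphB; congr (_ - _); first by congr (_, _); rewrite /= rmorph0.
  by congr (_, _); rewrite /= ?rmorph0 ?rmorph1.
pose D := \prod_i (xi i ^+ 2 - xi i).
have D0 : D != 0 by apply/prodf_neq0 => i _.
have U3 : U ^+ 3 = eisC D * (eisC 24%:R * (1 + th) ^+ 3).
  rewrite -prodrXl -eis_p.
  under eq_bigr do rewrite eis_sub_cube //.
  rewrite big_split; congr (_ * _); first by rewrite rmorph_prod.
  have <- : (map_poly (@eisC L) (ev (monicZ p_low) 'X)).[3%:R * th]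
      = ev (monicZ p_low) (3%:R * theta L).
    by rewrite map_ev horner_ev.
  (* Eight factors: signs cancel. *)
  have even8 (F : 'I_8 -> eis L) : \prod_i F i = \prod_i - F i.
    by rewrite prodrN card_ord -signr_odd mul1r.
  rewrite pE rmorph_prod horner_prod even8.
  by apply: eq_bigr => i _; rewrite rmorphB /= map_polyX map_polyC hornerXsubC opprB.
pose W := U * (2%:R - th).
have W3 : W ^+ 3 = eisC (D * 24%:R * 27%:R).
  rewrite exprMn U3 !rmorphM -[LHS]mulrA -[X in _ * X = _]mulrA -exprMn mulrA.
  congr (_ * _).
  have -> : (1 + th) * (2%:R - th) = eisC 3%:R.
    by rewrite -!(rmorph_nat (@eisC L)); congr (_, _) => /=; ring.
  by rewrite -rmorphXn -natrX.
have n3 : 3%:R != 0 :> L by apply: natr_neq0.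
have [|l [j WE]] := @eis_cube_scalar L W _ n3; first by rewrite W3.
have l0 : l != 0.
  apply: contraNneq D0 => l0; have : W ^+ 3 = 0 by rewrite WE l0 rmorph0 mul0r expr0n.
  rewrite W3 => /(congr1 fst)/eqP; rewrite /= !mulf_eq0 -orbA.
  by rewrite !(negPf (natr_neq0 _)) // !orbF.
have sW : eis_map s W = eisC lam * th ^+ S * W.
  rewrite -[LHS]/(eis_map s (U * (2%:R - th))).
  have -> : eis_map s (U * (2%:R - th)) = eis_map s U * (2%:R - th).
    rewrite [LHS]rmorphM; congr (_ * _); rewrite rmorphB rmorph_nat; congr (_ - _).
    by congr (_, _); rewrite /= ?rmorph0 ?rmorph1.
  by rewrite sU /W !mulrA.
have sl : eisC (lam * l) * th ^+ S = eisC (s l).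
  (* theta^(5j) is the inverse of theta^j. *)
  have th6 : th ^+ j * th ^+ (5 * j) = 1.
    by rewrite -exprD -mulSn exprM (exprM _ 3 2) theta3 sqrrN !expr1n.
  rewrite -[LHS]mulr1 -[RHS]mulr1 -th6 !mulrA; congr (_ * _).
  rewrite rmorphM /= -[X in X * _]mulrA [eisC l * _]mulrC mulrA -mulrA -WE -sW.
  rewrite WE rmorphM rmorphXn; congr (_ * _ ^+ _).
    by congr (_, _); rewrite /= rmorph0.
  by congr (_, _); rewrite /= ?rmorph0 ?rmorph1.
have S3 := eis_theta_power (mulf_neq0 lam0 l0) sl (erefl _).
have -> : \sum_i e i = S%:R :> 'Z_3.
  by rewrite natr_sum; apply: eq_bigr => i _; rewrite natr_Zp.
by rewrite (divn_eq S 3) S3 addn0 natrM mulrC (_ : 3%:R = 0) ?mul0r //; apply: val_inj.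
Qed.
End SumX.

Section Disc.
Variables (K : fieldType) (n : nat) (t : 'I_n -> K).
(** A square root of the discriminant. *)
Definition vdm := \det (Vandermonde n (\row_i t i)).

Lemma vdmE : vdm = \prod_(i < n) \prod_(j < n | (i < j)%N) (t j - t i).
Proof.
rewrite /vdm det_Vandermonde; apply: eq_bigr => i _; apply: eq_bigr => j _.
by rewrite !mxE.
Qed.

(** s permutes the columns of the Vandermonde matrix. *)
Lemma vdm_perm (s : {rmorphism K -> K}) (rho : {perm 'I_n}) :
  (forall i, s (t i) = t (rho i)) -> s vdm = (-1) ^+ rho * vdm.
Proof.
move=> s_t; rewrite /vdm -det_map_mx.
have -> : map_mx s (Vandermonde n (\row_i t i))
    = col_perm rho (Vandermonde n (\row_i t i)).
  by apply/matrixP => i j; rewrite !mxE rmorphXn s_t.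
by rewrite col_permE det_mulmx det_perm odd_permV mulrC.
Qed.

(** p'(t_i) is the product of the t_i - t_j over j <> i; each unordered pair
    occurs twice, with opposite signs. *)
Lemma vdm_sqr (p : {poly K}) : p = \prod_i ('X - (t i)%:P) ->
  vdm ^+ 2 = (-1) ^+ 'C(n, 2) * \prod_i p^`().[t i].
Proof.
move=> pE.
have p'E i : p^`().[t i] = \prod_(j < n | (j < i)%N) (t i - t j)
    * \prod_(j < n | (i < j)%N) (t i - t j).
  rewrite pE (bigD1 i) //= derivM derivXsubC mul1r hornerD hornerM hornerXsubC.
  rewrite subrr mul0r addr0 horner_prod.
  under eq_bigr do rewrite hornerXsubC.
  rewrite (bigID (fun j : 'I_n => (j < i)%N)) /=; congr (_ * _); apply: eq_bigl => j.
    by apply: andb_idl => lt_ji; rewrite -(inj_eq val_inj) /= ltn_eqF.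
  by rewrite -leqNgt ltn_neqAle eq_sym (inj_eq val_inj).
under eq_bigr do rewrite p'E.
rewrite big_split mulrCA expr2; congr (_ * _).
  by rewrite vdmE (exchange_big_dep xpredT).
rewrite [in RHS](exchange_big_dep xpredT) //= vdmE (exchange_big_dep xpredT) //=.
have <- : \prod_(j < n) ((-1) ^+ val j : K) = (-1) ^+ 'C(n, 2).
  by rewrite prodrXr -bin2_sum big_mkord.
rewrite -big_split /=; apply: eq_bigr => j _.
have cj : #|[pred i : 'I_n | (i < j)%N]| = val j.
  rewrite -sum1_card -(big_ord_widen n (fun=> 1%N)) ?sum1_card ?card_ord //.
  exact: ltnW.
transitivity (\prod_(i in [pred i : 'I_n | (i < j)%N]) - (t i - t j)).
  by apply: eq_bigr => i _; rewrite opprB.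
by rewrite prodrN cj.
Qed.

(** At a root t, t p'(t) = n t^n + b t = -(n-1) b (t + beta) with
    beta = n c / ((n-1) b).  In the product over the roots, the left side gives
    the constant term c times the unknown product, the right side the value of the
    polynomial at -beta; n being even removes the signs. *)
Lemma trinomial_disc b c : ~~ odd n -> (1 < n)%N -> b != 0 -> c != 0 ->
    n.-1%:R != 0 :> K ->
    'X^n + b *: 'X + c%:P = \prod_i ('X - (t i)%:P) ->
  \prod_i ('X^n + b *: 'X + c%:P)^`().[t i]
    = n%:R ^+ n * c ^+ n.-1 - n.-1%:R ^+ n.-1 * b ^+ n.
Proof.
move=> even_n n_gt1 b0 c0 n0 pE.
have prodN (F : 'I_n -> K) : \prod_i - F i = \prod_i F i.
  by rewrite prodrN card_ord -signr_odd (negPf even_n) mul1r.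
have prod_t : \prod_i t i = c.
  have := congr1 (fun p => p.[0]) pE.
  rewrite !hornerD hornerZ hornerX hornerC hornerXn expr0n.
  rewrite gtn_eqF ?(ltnW n_gt1) // mulr0 !add0r horner_prod => ->.
  by rewrite -prodN; apply: eq_bigr => i _; rewrite hornerXsubC sub0r.
have root_t i : t i ^+ n + b * t i + c = 0.
  have : ('X^n + b *: 'X + c%:P).[t i] == 0.
    by rewrite pE horner_prod (bigD1 i) //= hornerXsubC subrr mul0r.
  by rewrite !hornerD hornerZ hornerX hornerC hornerXn => /eqP.
pose m : K := n.-1%:R; have nE : n%:R = m + 1 :> K by rewrite /m natr1 prednK // ltnW.
pose beta := n%:R * c / (m * b).
have t_p' i : t i * ('X^n + b *: 'X + c%:P)^`().[t i] = - (m * b) * (t i + beta).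
  rewrite !derivD derivC derivZ derivX derivXn alg_polyC addr0 hornerD hornerMn hornerXn hornerC.
  have /eqP := root_t i; rewrite -addrA addr_eq0 => /eqP root_i.
  rewrite mulrDr mulrnAr -exprS prednK ?(ltnW n_gt1) // root_i -[_ *+ n]mulr_natr.
  by rewrite /beta nE; field; rewrite b0 n0.
have : c * \prod_i ('X^n + b *: 'X + c%:P)^`().[t i]
   = (m * b) ^+ n * (beta ^+ n - b * beta + c).
  rewrite -{1}prod_t -big_split /=.
  under eq_bigr do rewrite t_p'.
  rewrite big_split /= prodr_const card_ord exprNn -signr_odd (negPf even_n) mul1r.
  congr (_ * _); have := congr1 (fun p => p.[- beta]) pE.
  rewrite !hornerD hornerZ hornerX hornerC hornerXn exprNn -signr_odd.
  rewrite (negPf even_n) mul1r horner_prod mulrN => ->.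
  by rewrite -prodN; apply: eq_bigr => i _; rewrite hornerXsubC opprD addrC.
move=> e; apply: (mulfI c0); rewrite e /beta exprMn.
have [k nk] : exists k, n = k.+2 by case: (n) n_gt1 => [|[|k]] // _; exists k.
move: nE n0; rewrite /m nk /=.
move: (k.+2%:R : K) (k.+1%:R : K) => N M nE n0; rewrite -exprMn.
have -> : b * (N * c / (M * b)) = N * c / M by field; rewrite n0 b0.
have mb0 : M * b != 0 by rewrite mulf_neq0.
rewrite -addrA mulrDr -exprMn [M * b * _]mulrC divfK // !exprMn.
rewrite [c ^+ k.+2]exprS [M ^+ k.+2]exprS nE.
move: (_ ^+ k.+2) (c ^+ _) (M ^+ _) (b ^+ _) => x y z w; by field.
Qed.
End Disc.

Section Invariants.
Variables (L : splittingFieldType rat) (s : gal_of {:L}).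
Local Notation num := (zr L sqrt_num).
Local Notation den := (zr L sqrt_den).

(** x is y or -y. *)
Lemma gal_sqrt (x y : L) : s y = y -> x ^+ 2 = y ^+ 2 -> s x = x.
Proof.
by move=> sy /eqP; rewrite eqf_sqr => /orP[] /eqP -> //; rewrite rmorphN /= sy.
Qed.

Lemma vdm_neq0 n (t : 'I_n -> L) : injective t -> vdm t != 0.
Proof.
move=> injt; rewrite vdmE; apply/prodf_neq0 => i _; apply/prodf_neq0 => j lt_ij.
by rewrite subr_eq0 (inj_eq injt) -(inj_eq val_inj) gtn_eqF.
Qed.

Lemma sqr_vdm_p (t : 'I_8 -> L) :
  ev (monicZ p_low) 'X = \prod_i ('X - (t i)%:P) -> vdm t ^+ 2 = zr L disc_p.
Proof.
rewrite ev_monic_trinomial -!(rmorph_zr polyC) /= mul_polyC => pE.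
rewrite (vdm_sqr pE) trinomial_disc ?zr_neq0 ?natr_neq0 //.
have -> : (-1) ^+ 'C(8, 2) = 1 :> L by rewrite -signr_odd.
rewrite mul1r.
by rewrite /disc_p zrD zrN [X in _ = X - _]zrM [X in _ = _ - X]zrM !zr_exp !zr_pos.
Qed.

(** The factor num^22 den^240 of the discriminant of h is a square. *)
Lemma sqr_vdm_h (t : 'I_12 -> L) :
    ev (monicZ h_low) 'X = \prod_i ('X - (t i)%:P) ->
  vdm t ^+ 2 = (num ^+ 11 * den ^+ 120) ^+ 2 * zr L disc_h.
Proof.
have num0 : num != 0 by apply: zr_neq0.
have den0 : den != 0 by apply: zr_neq0.
rewrite ev_monic_trinomial -!(rmorph_zr polyC) /= mul_polyC => hE.
have h1E : zr L h_lin = num ^+ 2 * den ^+ 20 by rewrite /h_lin zrM !zr_exp.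
have h0E : zr L h_const = num ^+ 2 * den ^+ 22 by rewrite /h_const zrM !zr_exp.
rewrite h1E h0E in hE; rewrite (vdm_sqr hE) trinomial_disc ?natr_neq0 //; last first.
- by rewrite mulf_neq0 ?expf_neq0.
- by rewrite mulf_neq0 ?expf_neq0.
have -> : (-1) ^+ 'C(12, 2) = 1 :> L by rewrite -signr_odd.
rewrite mul1r /disc_h zrD zrN [X in _ * (X - _)]zrM [X in _ * (_ - X)]zrM !zr_exp.
rewrite (zr_pos _ 12) (zr_pos _ 11).
have -> : (num ^+ 2 * den ^+ 22) ^+ 11 = (num ^+ 11 * den ^+ 120) ^+ 2 * den ^+ 2.
  by move: num den => a b; ring.
have -> : (num ^+ 2 * den ^+ 20) ^+ 12 = (num ^+ 11 * den ^+ 120) ^+ 2 * num ^+ 2.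
  by move: num den => a b; ring.
rewrite mulrBr; congr (_ - _); exact: mulrCA.
Qed.

(** The product of the two Vandermonde determinants squares to the square of an
    integer, so it is an integer and s fixes it; s multiplies it by the product of
    the signs. *)
Lemma sign_eq (t : 'I_8 -> L) (z : 'I_12 -> L) (rho : {perm 'I_8}) (sigma : {perm 'I_12}) :
    injective t -> injective z ->
    ev (monicZ p_low) 'X = \prod_i ('X - (t i)%:P) ->
    ev (monicZ h_low) 'X = \prod_i ('X - (z i)%:P) ->
    (forall i, s (t i) = t (rho i)) -> (forall i, s (z i) = z (sigma i)) ->
  odd_perm rho = odd_perm sigma.
Proof.
move=> injt injz pE hE s_t s_z.
have fix_v : s (vdm t * vdm z) = vdm t * vdm z.
  apply: (@gal_sqrt _ (num ^+ 11 * den ^+ 120 * zr L sqrt_disc)).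
    suff -> : num ^+ 11 * den ^+ 120 * zr L sqrt_disc
      = zr L (sqrt_num ^ 11 * sqrt_den ^ 120 * sqrt_disc)%ZZ by rewrite rmorph_zr.
    by rewrite [RHS]zrM; congr (_ * _); rewrite [RHS]zrM !zr_exp.
  have discE : zr L sqrt_disc ^+ 2 = zr L disc_p * zr L disc_h.
    by rewrite -zrM -sqrt_discE zr_exp.
  by rewrite exprMn sqr_vdm_p // sqr_vdm_h // [RHS]exprMn discE mulrCA.
have nz : vdm t * vdm z != 0 by rewrite mulf_neq0 ?vdm_neq0.
move: fix_v; rewrite rmorphM (vdm_perm s_t) (vdm_perm s_z) mulrACA -signr_addb.
rewrite -[RHS]mul1r => /(mulIf nz).
have n1 : (1 == -1 :> L) = false.
  by rewrite -subr_eq0 opprK (negPf (natr_neq0 _ (isT : 2 != 0)%N)).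
by case: (odd_perm rho) (odd_perm sigma) => [] [] //= /eqP; rewrite expr1 ?(eq_sym _ 1) n1.
Qed.

(** The product of the w i is num den^11 up to sign, so it is fixed, whereas s
    multiplies it by -1 to the power of the number of flips. *)
Lemma sum_y_eq0 (w : 'I_12 -> L) (sigma : {perm 'I_12}) (e : 'I_12 -> 'Z_2) :
    injective (fun i => w i ^+ 2) ->
    ev (monicZ h_low) 'X = \prod_i ('X - (w i ^+ 2)%:P) ->
    (forall i, s (w i) = iter (val (e i)) -%R (w (sigma i))) ->
  \sum_i e i = 0.
Proof.
move=> injw hE s_w.
have num0 : num != 0 by apply: zr_neq0.
have den0 : den != 0 by apply: zr_neq0.
pose Pw := \prod_i w i.
have Pw2 : Pw ^+ 2 = (num * den ^+ 11) ^+ 2.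
  rewrite -prodrXl; have := congr1 (fun p => p.[0]) hE.
  rewrite horner_ev h_eval expr0n mulr0 !add0r exprMn -exprM => ->.
  rewrite horner_prod -[LHS]mul1r; under [in RHS]eq_bigr do rewrite hornerXsubC sub0r.
  by rewrite prodrN card_ord -signr_odd.
have Pw0 : Pw != 0.
  by rewrite -[_ == 0](@expf_eq0 _ _ 2) Pw2 expf_neq0 // mulf_neq0 ?expf_neq0.
have sPw : s Pw = Pw.
  apply: gal_sqrt Pw2.
  suff -> : num * den ^+ 11 = zr L (sqrt_num * sqrt_den ^ 11)%ZZ by rewrite rmorph_zr.
  by rewrite [RHS]zrM zr_exp.
have signE i : s (w i) = (-1) ^+ (val (e i)) * w (sigma i).
  rewrite s_w; elim: (val _) => [|m IHm] /=; first by rewrite mul1r.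
  by rewrite IHm exprS mulN1r mulNr.
pose S := (\sum_i val (e i))%N.
have : s Pw = (-1) ^+ S * Pw.
  rewrite rmorph_prod /= (eq_bigr _ (fun i _ => signE i)) big_split /= prodrXr.
  by congr (_ * _); rewrite [RHS](reindex_inj (@perm_inj _ sigma)).
rewrite sPw -[LHS]mul1r => /(mulIf Pw0).
have -> : \sum_i e i = S%:R :> 'Z_2.
  by rewrite natr_sum; apply: eq_bigr => i _; rewrite natr_Zp.
rewrite -signr_odd; have := odd_double_half S.
case: (odd S) => /= [_ /eqP|<- _].
  by rewrite expr1 -subr_eq0 opprK (negPf (natr_neq0 _ (isT : 2 != 0)%N)).
by rewrite add0n -muln2 natrM (_ : 2%:R = 0) ?mulr0 //; apply: val_inj.
Qed.
End Invariants.

(** * Cycle types of Frobenius elements *)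

Section Reduction.
Variables (L : splittingFieldType rat) (P : positive) (k : fieldType).
Variables (phi : {rmorphism algint L -> k}) (s : gal_of {:L}).
Hypothesis P0 : (Pos.to_nat P)%:R = 0 :> k.
Hypothesis frob : forall a, phi (gal_algint s a) = phi a ^+ Pos.to_nat P.

Lemma zrP0 : zr k (Zpos P) = 0. Proof. by rewrite zr_pos. Qed.

Lemma frob_expg m a : phi (gal_algint (s ^+ m)%g a) = phi a ^+ (Pos.to_nat P ^ m).
Proof.
elim: m => [|m IHm]; first by rewrite expr1; congr (phi _); apply: val_inj; rewrite /= gal_id.
rewrite expnSr exprM -IHm -frob; congr (phi _); apply: val_inj.
by rewrite /= expgSr galM ?memvf.
Qed.

Lemma ev_monic_mod (A : comNzRingType) Q q (x : A) : zr A Q = 0 ->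
  ev (monicZ (pmod Q q)) x = ev (monicZ q) x.
Proof. by move=> Q0; rewrite !ev_monic ev_mod // size_map. Qed.

Variables (n : nat) (q : seq Z) (t : 'I_n -> algint L) (rho : {perm 'I_n}).
Hypothesis qE : ev (monicZ q) 'X = \prod_i ('X - (val (t i))%:P) :> {poly L}.
Hypothesis s_t : forall i, s (val (t i)) = val (t (rho i)).
Local Notation r i := (phi (t i)).

Lemma red_prod : ev (monicZ q) 'X = \prod_i ('X - (r i)%:P).
Proof.
pose iota : {rmorphism algint L -> L} := (val : algint L -> L).
have tE : map_poly iota (ev (monicZ q) 'X) = map_poly iota (\prod_i ('X - (t i)%:P)).
  rewrite map_ev qE rmorph_prod; apply: eq_bigr => i _.
  by rewrite [RHS](map_polyXsubC iota).
have {}tE : ev (monicZ q) 'X = \prod_i ('X - (t i)%:P).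
  apply/polyP => i; apply: (val_inj : injective iota).
  by rewrite -!(coef_map iota) tE.
rewrite -(map_ev phi) tE rmorph_prod; apply: eq_bigr => i _.
exact: map_polyXsubC.
Qed.

Lemma red_root i : ev (monicZ q) (r i) = 0.
Proof.
by rewrite -horner_ev red_prod horner_prod (bigD1 i) //= hornerXsubC subrr mul0r.
Qed.

Lemma gal_expg m i : gal_algint (s ^+ m)%g (t i) = t ((rho ^+ m)%g i).
Proof.
apply: val_inj; elim: m => [|m IHm]; first by rewrite /= gal_id perm1.
by rewrite /= expgSr galM ?memvf // -[(s ^+ m)%g _]/(val (gal_algint _ _)) IHm s_t expgSr permM.
Qed.

Lemma frob_root m i : r ((rho ^+ m)%g i) = r i ^+ (Pos.to_nat P ^ m).
Proof. by rewrite -frob_expg gal_expg. Qed.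

Lemma red_nofix q' m u v i : nofix_cert P q' m u v -> ev (monicZ q') (r i) = 0 ->
  (rho ^+ m)%g i != i.
Proof.
move=> cert q'0; apply/eqP => fix_i.
by apply: (nofix_certP zrP0 cert q'0); rewrite -frob_root fix_i.
Qed.

Variables (u v : seq Z).
Hypothesis sep : sep_cert P q u v.

(** The reduction of the polynomial stays separable, so the permutation of the
    roots can be read off from their images under phi. *)
Lemma red_inj : injective (fun i => r i).
Proof.
pose rs := [seq r i | i <- enum 'I_n].
have uniq_rs : uniq rs.
  apply: (@uniq_simple_roots _ (ev (monicZ q) 'X)).
    by rewrite red_prod big_map big_enum.
  move=> x; rewrite deriv_ev !horner_ev => qx q'x.
  exact: (sep_certP zrP0 sep qx q'x).
by apply/injectiveP; rewrite /injectiveb /dinjectiveb.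
Qed.

Lemma red_fix q' m i : fix_cert P q' m -> ev (monicZ q') (r i) = 0 ->
  (rho ^+ m)%g i = i.
Proof.
by move=> cert q'0; apply: red_inj; rewrite frob_root (fix_certP zrP0 cert).
Qed.

(** Suppose q = ab modulo P, where Frobenius to the power m is trivial on the
    roots of a and moves all the roots of b. *)
Section Split.
Variables (a b ub vb : seq Z) (m : nat).
Hypothesis ab : peqmod (Zpos P) (monicZ q) (pmul (monicZ a) (monicZ b)).
Hypothesis fix_a : fix_cert P a m.
Hypothesis nofix_b : nofix_cert P b m ub vb.
Hypothesis sab : (size a + size b)%N = n.

Lemma fixed_root_or i : ev (monicZ a) (r i) = 0 \/ ev (monicZ b) (r i) = 0.
Proof.
have /eqP := ev_eqmod zrP0 (r i) ab.
by rewrite ev_mul red_root eq_sym mulf_eq0 => /orP[] /eqP; [left | right].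
Qed.

Lemma fixed_rootE i : ((rho ^+ m)%g i == i) = (ev (monicZ a) (r i) == 0).
Proof.
apply/eqP/eqP => [fix_i|a0]; last exact: red_fix fix_a a0.
have [//|b0] := fixed_root_or i.
by have := red_nofix nofix_b b0; rewrite fix_i eqxx.
Qed.

Lemma moved_rootE i : ((rho ^+ m)%g i != i) = (ev (monicZ b) (r i) == 0).
Proof.
apply/idP/eqP => [|b0]; last exact: red_nofix nofix_b b0.
by rewrite fixed_rootE => a0; have [a0'|//] := fixed_root_or i; rewrite a0' eqxx in a0.
Qed.

(** Each count is at most the degree of the factor, and the degrees add up to
    n. *)
Lemma card_fixed_moved :
  #|[set i | (rho ^+ m)%g i == i]| = size a /\
  #|[set i | (rho ^+ m)%g i != i]| = size b.
Proof.
set F := [set i | _ == _]; set M := [set i | _].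
have leF : (#|F| <= size a)%N.
  rewrite (_ : F = [set i | ev (monicZ a) (r i) == 0%R]); first exact: card_roots red_inj.
  by apply/setP => i; rewrite !inE fixed_rootE.
have leM : (#|M| <= size b)%N.
  rewrite (_ : M = [set i | ev (monicZ b) (r i) == 0%R]); first exact: card_roots red_inj.
  by apply/setP => i; rewrite !inE moved_rootE.
have MF : M = ~: F by apply/setP => i; rewrite !inE.
have := cardsC F; rewrite -MF card_ord; lia.
Qed.
End Split.
End Reduction.

(** * The Galois group *)

Definition shanks (A : comNzRingType) (c x : A) :=
  x ^+ 3 - c * x ^+ 2 + (c - 3%:R) * x + 1.

Lemma rmorph_shanks (A B : comNzRingType) (f : {rmorphism A -> B}) c x :
  f (shanks c x) = shanks (f c) (f x).
Proof.
rewrite /shanks rmorphD rmorph1 rmorphD rmorphB rmorphXn /= [f (c * _)]rmorphM /=.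
by rewrite rmorphXn /= [f ((c - _) * _)]rmorphM /= rmorphB rmorph_nat.
Qed.

Section Cube.
Variables (L : splittingFieldType rat) (xi : 'I_8 -> L) (w : 'I_12 -> L).
Local Notation inL := (map_poly (in_alg L)).
Local Notation den := (zr L sqrt_den).
Local Notation tau := (@tau3 L).
Local Notation pt3 := (@fiber_point L 8 3 tau xi).
Local Notation pt2 := (@fiber_point L 12 2 -%R w).
Local Notation t := (fun i => kappa3 (xi i)).
Local Notation z := (fun i => w i ^+ 2).

Hypothesis f_inj : injective pt3.
Hypothesis f_roots : forall x, root (inL f_poly) x <->
  exists u : 'I_8 * 'Z_3, x = pt3 u.
Hypothesis t_inj : injective (@kappa3 L \o xi).
Hypothesis pE : ev (monicZ p_low) 'X = \prod_i ('X - (t i)%:P).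
Hypothesis g_inj : injective pt2.
Hypothesis g_roots : forall x, root (inL g_poly) x <->
  exists u : 'I_12 * 'Z_2, den * x = pt2 u.
Hypothesis z_inj : injective (fun i => w i ^+ 2).
Hypothesis hE : ev (monicZ h_low) 'X = \prod_i ('X - (z i)%:P).

Lemma gal_map_root (s : gal_of {:L}) (p : {poly rat}) x :
  root (inL p) x -> root (inL p) (s x).
Proof.
move=> px; have -> : inL p = map_poly s (inL p); last exact: rmorph_root.
by rewrite -map_poly_comp; apply: eq_map_poly => c /=; rewrite linearZ /= rmorph1.
Qed.

Lemma f_point u : ev (monicZ f_low) (pt3 u) = 0.
Proof.
have /f_roots : exists v : 'I_8 * 'Z_3, pt3 u = pt3 v.
  by exists u.
by rewrite f_polyE /root horner_ev => /eqP.
Qed.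

Lemma xi_good i : xi i != 0 /\ xi i != 1.
Proof. by have /f_root_kappa[] := f_point (i, 0). Qed.

(** The three points of a fibre of kappa form an orbit of tau, cf.
    [kappa3_fiber]. *)
Lemma kappa_tau y : y != 0 -> y != 1 -> kappa3 (tau y) = kappa3 y.
Proof.
move=> y0 y1; have [t0 t1] := tau3_good y0 y1.
have y1' : 1 - y != 0 by rewrite subr_eq0 eq_sym.
have D0 := kappa3_den_neq0 y0 y1; have D0' := kappa3_den_neq0 t0 t1.
rewrite /kappa3; apply/eqP; rewrite eqr_div //; apply/eqP; rewrite /tau3.
by field.
Qed.

Lemma kappa_iter m x : x != 0 -> x != 1 -> kappa3 (iter m tau x) = kappa3 x.
Proof.
move=> x0 x1; suff [_ [_ ->]] : iter m tau x != 0 /\ iter m tau x != 1 /\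
  kappa3 (iter m tau x) = kappa3 x by [].
elim: m => [|m [y0 [y1 <-]]] //; have [t0 t1] := tau3_good y0 y1.
by split=> //; split=> //; apply: kappa_tau.
Qed.

Lemma gal_tau3 (s : gal_of {:L}) x : s (tau x) = tau (s x).
Proof. by rewrite /tau3 fmorphV rmorphB rmorph1. Qed.

Lemma gal_opp (s : gal_of {:L}) x : s (- x) = - s x.
Proof. exact: rmorphN. Qed.

Lemma gal_xi (s : gal_of {:L}) i : exists u, s (xi i) = pt3 u.
Proof.
by apply/f_roots/gal_map_root/f_roots; exists (i, 0).
Qed.

Lemma gal_w (s : gal_of {:L}) i : exists u, s (w i) = pt2 u.
Proof.
have /g_roots/(gal_map_root s)/g_roots[u uE] : exists u : 'I_12 * 'Z_2,
    den * (den^-1 * w i) = pt2 u.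
  by exists (i, 0); rewrite mulVKf ?den_neq0.
exists u; rewrite -uE -[in LHS](mulVKf (den_neq0 L) (w i)) rmorphM /=.
by rewrite rmorph_zr.
Qed.

Lemma cube_action : exists Phi : gal_of {:L} -> cube_group,
  [/\ forall (s : gal_of {:L}) i (e : 'Z_3), s (pt3 (i, e))
       = pt3 ((Phi s).1.2 i, (Phi s).1.1 i + e),
      forall (s : gal_of {:L}) i (e : 'Z_2), s (pt2 (i, e))
       = pt2 ((Phi s).2.2 i, (Phi s).2.1 i + e) &
      {morph Phi : s s' / (s * s')%g}].
Proof.
have [|Phi8 [Phi8E Phi8M]] :=
    wreath_action (isT : (1 < 3)%N) f_inj _ gal_tau3 gal_xi.
  by move=> i; have [x0 x1] := xi_good i; apply: tau3_order.
have [|Phi12 [Phi12E Phi12M]] :=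
    wreath_action (isT : (1 < 2)%N) g_inj _ gal_opp gal_w.
  by move=> i /=; rewrite opprK.
exists (fun s => (Phi8 s, Phi12 s)); split=> // s s'.
by rewrite Phi8M Phi12M.
Qed.

Variable Phi : gal_of {:L} -> cube_group.
Hypothesis Phi8E : forall (s : gal_of {:L}) i (e : 'Z_3), s (pt3 (i, e))
       = pt3 ((Phi s).1.2 i, (Phi s).1.1 i + e).
Hypothesis Phi12E : forall (s : gal_of {:L}) i (e : 'Z_2), s (pt2 (i, e))
       = pt2 ((Phi s).2.2 i, (Phi s).2.1 i + e).
Hypothesis PhiM : {morph Phi : s s' / (s * s')%g}.

Lemma gal_xiE (s : gal_of {:L}) i :
  s (xi i) = iter (val ((Phi s).1.1 i)) tau (xi ((Phi s).1.2 i)).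
Proof. by have := Phi8E s i 0; rewrite addr0. Qed.

Lemma gal_wE (s : gal_of {:L}) i :
  s (w i) = iter (val ((Phi s).2.1 i)) -%R (w ((Phi s).2.2 i)).
Proof. by have := Phi12E s i 0; rewrite addr0. Qed.

Lemma gal_kappa (s : gal_of {:L}) x : s (kappa3 x) = kappa3 (s x).
Proof.
rewrite /kappa3 fmorph_div; congr (_ / _); last by rewrite rmorphB rmorphXn.
by rewrite rmorphD rmorphB rmorph1 rmorphXn [X in _ - X]rmorphM rmorph_nat.
Qed.

Lemma gal_tE (s : gal_of {:L}) i : s (t i) = t ((Phi s).1.2 i).
Proof.
rewrite gal_kappa gal_xiE; have [x0 x1] := xi_good ((Phi s).1.2 i).
exact: kappa_iter.
Qed.

Lemma gal_zE (s : gal_of {:L}) i : s (z i) = z ((Phi s).2.2 i).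
Proof.
rewrite rmorphXn /= gal_wE; elim: (val _) => //= m <-.
by rewrite sqrrN.
Qed.

Lemma Phi_rubik s : Phi s \in rubik.
Proof.
have sx : \sum_i (Phi s).1.1 i = 0 := sum_x_eq0 xi_good (gal_xiE s) pE.
have sy : \sum_i (Phi s).2.1 i = 0 := sum_y_eq0 z_inj hE (gal_wE s).
have sg := sign_eq t_inj z_inj pE hE (gal_tE s) (gal_zE s).
case: (Phi s) sx sy sg => [[x rho] [y sigma]] /= sx sy sg.
by rewrite in_rubik sx sy sg !eqxx; case: (odd_perm sigma).
Qed.

Lemma p_t i : ev (monicZ p_low) (t i) = 0.
Proof. by rewrite -horner_ev pE horner_prod (bigD1 i) //= hornerXsubC subrr mul0r. Qed.

Lemma g_w i : ev (monicZ g_low) (w i) = 0.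
Proof.
rewrite /g_low ev_monic_double -horner_ev hE horner_prod (bigD1 i) //=.
by rewrite hornerXsubC subrr mul0r.
Qed.

Definition xi_int i := sval (algint_lift (integral_ev (f_point (i, 0)))).
Definition t_int i := sval (algint_lift (integral_ev (p_t i))).
Definition w_int i := sval (algint_lift (integral_ev (g_w i))).
Definition z_int i := w_int i ^+ 2.

Lemma val_xi_int i : val (xi_int i) = xi i.
Proof. exact: svalP (algint_lift _). Qed.
Lemma val_t_int i : val (t_int i) = t i.
Proof. exact: svalP (algint_lift _). Qed.
Lemma val_w_int i : val (w_int i) = w i.
Proof. exact: svalP (algint_lift _). Qed.
Lemma val_z_int i : val (z_int i) = z i.
Proof. by rewrite /= -val_w_int. Qed.

Lemma p_intE : ev (monicZ p_low) 'X = \prod_i ('X - (val (t_int i))%:P).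
Proof. by rewrite pE; apply: eq_bigr => i _; rewrite val_t_int. Qed.
Lemma h_intE : ev (monicZ h_low) 'X = \prod_i ('X - (val (z_int i))%:P).
Proof. by rewrite hE; apply: eq_bigr => i _; rewrite val_z_int. Qed.
Lemma gal_t_int (s : gal_of {:L}) i : s (val (t_int i)) = val (t_int ((Phi s).1.2 i)).
Proof. by rewrite !val_t_int gal_tE. Qed.
Lemma gal_z_int (s : gal_of {:L}) i : s (val (z_int i)) = val (z_int ((Phi s).2.2 i)).
Proof. by rewrite !val_z_int gal_zE. Qed.

Lemma frob97 : exists s, (forall i, (Phi s).1.2 i != i) /\ (forall i, (Phi s).2.2 i != i).
Proof.
have prP : prime (Pos.to_nat 97) by vm_compute.
have [k [phi [s [P0 frob]]]] := @frobenius_lift L _ prP.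
have Pz := zrP0 P0.
exists s; split=> i.
  have := red_nofix P0 frob (gal_t_int s) p_97_moved; rewrite expg1; apply.
  exact: red_root p_intE _.
have := red_nofix P0 frob (gal_z_int s) h_97_moved; rewrite expg1; apply.
by rewrite (ev_monic_mod _ _ Pz); apply: red_root h_intE _.
Qed.

(** xi i is a root of a monic cubic over Z[t_i], so its residue is controlled by
    that of t_i. *)
Lemma cubic_xi i : shanks (t_int i) (xi_int i) = 0.
Proof.
apply: val_inj; rewrite (rmorph_shanks (val : {rmorphism algint L -> L})).
rewrite [_ (t_int i)]val_t_int [_ (xi_int i)]val_xi_int rmorph0 /shanks /kappa3.
by have [x0 x1] := xi_good i; have := kappa3_den_neq0 x0 x1 => D0; field.
Qed.

(** The 1 + 7 and 1 + 11 factorizations give one fixed corner and one fixed edge.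
    The residue of the fixed corner is 16; if it were not twisted, then s would
    fix xi, and the residue of xi would be a root of X^3 - 16 X^2 + 13 X + 1 fixed
    by Frobenius, but there is none. *)
Lemma frob233 : exists s, [/\ ((Phi s).1.2 ^+ 7 = 1)%g,
  exists i0, (forall i, ((Phi s).1.2 i == i) = (i == i0)) /\ (Phi s).1.1 i0 != 0,
  ((Phi s).2.2 ^+ 11 = 1)%g &
  exists i0, forall i, ((Phi s).2.2 i == i) = (i == i0)].
Proof.
have [k [phi [s [P0 frob]]]] := @frobenius_lift L _ prime233.
have Pz := zrP0 P0.
have sep_h : sep_cert 233 h_low sep233_h_u sep233_h_v := h_233_separable.
have unique_fixed n (rho : {perm 'I_n}) (a : seq Z) : size a = 1%N ->
    #|[set i | (rho ^+ 1)%g i == i]| = size a ->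
    exists i0, forall i, (rho i == i) = (i == i0).
  by move=> -> /eqP/cards1P => [[i0 e]]; exists i0 => i; move/setP/(_ i): e; rewrite !inE expg1.
have [p_card _] := card_fixed_moved P0 frob p_intE
  (gal_t_int s) p_233_separable p_233_split p_233_fixed p_233_moved erefl.
have [h_card _] := card_fixed_moved P0 frob h_intE
  (gal_z_int s) sep_h h_233_split h_233_fixed h_233_moved erefl.
exists s; split.
- apply/permP => i; rewrite perm1; apply: (red_fix P0 frob p_intE
    (gal_t_int s) p_233_separable p_233_order).
  exact: red_root p_intE _.
- have [i0 fix_i0] := unique_fixed _ _ fixed233_p erefl p_card.
  exists i0; split; first exact: fix_i0.
  have := fixed_rootE P0 frob p_intE
    (gal_t_int s) p_233_separable p_233_split p_233_fixed p_233_moved i0.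
  rewrite expg1 fix_i0 eqxx => /esym/eqP.
  rewrite /= zr1 mulr0 addr0 mulr1 => /eqP; rewrite addrC addr_eq0 => /eqP r_i0.
  apply/negP => /eqP x0.
  have fix_xi : gal_algint s (xi_int i0) = xi_int i0.
    apply: val_inj; rewrite /= val_xi_int gal_xiE x0 /=.
    by move/(_ i0): fix_i0; rewrite eqxx => /eqP ->.
  have cub : ev (monicZ cubic233) (phi (xi_int i0)) = 0.
    (* The coefficients 217 = -16 and 13 = 16 - 3 of cubic233. *)
    have e13 : zr k 13 = - zr k 217 - 3%:R.
      apply/eqP; rewrite -subr_eq0 opprB opprK addrA -(zr_pos k 3) -!zrD.
      by rewrite -[X in zr _ X]/233%ZZ Pz.
    have := congr1 phi (cubic_xi i0); rewrite rmorph_shanks rmorph0 r_i0 => <-.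
    rewrite /= zr1 e13 /shanks; ring.
  by apply: (nofix_certP Pz cubic_233_moved cub); rewrite expn1 -frob fix_xi.
- apply/permP => i; rewrite perm1; apply: (red_fix P0 frob h_intE
    (gal_z_int s) sep_h h_233_order).
  by rewrite (ev_monic_mod _ _ Pz); apply: red_root h_intE _.
exact: (unique_fixed _ _ fixed233_h erefl h_card).
Qed.

Lemma Phi_expg s m : Phi (s ^+ m)%g = (Phi s ^+ m)%g.
Proof.
elim: m => [|m IHm]; last by rewrite !expgS PhiM IHm.
have := PhiM 1%g 1%g; rewrite mulg1 => /(congr1 (mulg (Phi 1%g)^-1)).
by rewrite mulVg mulKg => <-.
Qed.

(** The ninth power moves only the two roots of the quadratic factors.  The 54th
    power fixes the roots of p and h, and on w it is 1 or -1 according to the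
    factor of h that w^2 annihilates; the two cases differ as w is nonzero and
    439 is odd. *)
Lemma frob439 : exists s, [/\
  exists a b, a != b /\ ((Phi s).1.2 ^+ 9 = tperm a b)%g,
  exists a b, a != b /\ ((Phi s).2.2 ^+ 9 = tperm a b)%g &
  exists i j, (Phi (s ^+ 54)%g).2.1 i != (Phi (s ^+ 54)%g).2.1 j].
Proof.
have prP : prime (Pos.to_nat 439) by vm_compute.
have [k [phi [s [P0 frob]]]] := @frobenius_lift L _ prP.
have Pz := zrP0 P0.
have transp n (rho : {perm 'I_n}) (b : seq Z) : size b = 2%N ->
    #|[set i | (rho ^+ 9)%g i != i]| = size b ->
    exists a b, a != b /\ (rho ^+ 9 = tperm a b)%g.
  by move=> ->; apply: card_moved_tperm.
have [_ p_card] := card_fixed_moved P0 frob p_intE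
  (gal_t_int s) p_439_separable p_439_split p_439_fixed p_439_moved erefl.
have [h_fixed h_moved] := card_fixed_moved P0 frob h_intE
  (gal_z_int s) h_439_separable h_439_split h_439_fixed h_439_moved erefl.
exists s; split.
- exact: (transp _ _ moved439_p erefl p_card).
- exact: (transp _ _ moved439_h erefl h_moved).
have ex_root (b : seq Z) (Q : pred 'I_12) : #|[set i | Q i]| = size b -> (0 < size b)%N ->
    exists i, Q i.
  by move=> <- /card_gt0P[i]; rewrite inE => Qi; exists i.
have [i iM] := ex_root _ _ h_moved erefl.
have [j jF] := ex_root _ _ h_fixed erefl.
rewrite (moved_rootE P0 frob h_intE (gal_z_int s) h_439_separable
  h_439_split h_439_fixed h_439_moved) in iM.
rewrite (fixed_rootE P0 frob h_intE (gal_z_int s) h_439_separable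
  h_439_split h_439_fixed h_439_moved) in jF.
have w_i : phi (w_int i) ^+ (Pos.to_nat 439 ^ 54) = - phi (w_int i).
  apply: (neg_certP Pz g_439_negated); rewrite ev_monic_double -rmorphXn; exact/eqP.
have w_j : phi (w_int j) ^+ (Pos.to_nat 439 ^ 54) = phi (w_int j).
  apply: (fix_certP Pz g_439_fixed); rewrite ev_monic_double -rmorphXn; exact/eqP.
have h0_neq0 : zr k h_const <> 0.
  move=> h00; have := ev_eqmod Pz (0 : k) h_439_const_unit; rewrite ev_mul /= h00 zr1.
  by rewrite !mul0r !addr0 mulr0 => /eqP; rewrite eq_sym oner_eq0.
have w_neq0 l : phi (w_int l) != 0.
  apply/eqP => w0; have := red_root phi h_intE l.
  by rewrite rmorphXn w0 ev_monic_trinomial !expr0n mulr0 !add0r.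
have neg_neq l : phi (w_int l) <> - phi (w_int l).
  move=> /eqP; rewrite -addr_eq0 -mulr2n -mulr_natl mulf_eq0 (negPf (w_neq0 l)) orbF.
  move=> /eqP two0; have := Pz; rewrite -[439%ZZ]/(219 * 2 + 1)%ZZ zrD zrM.
  by rewrite (zr_pos _ 2) two0 mulr0 add0r zr1 => /eqP; rewrite oner_eq0.
have perm1_54 : (Phi (s ^+ 54)%g).2.2 = 1%g.
  rewrite Phi_expg expg_2_2; have [a [b [_ e]]] := transp _ _ moved439_h erefl h_moved.
  by rewrite (expgM _ 9 6) e (expgM _ 2 3) expg2 tperm2 expg1n.
have gal_w54 l : val (gal_algint (s ^+ 54)%g (w_int l))
    = iter (val ((Phi (s ^+ 54)%g).2.1 l)) -%R (w l).
  by rewrite /= val_w_int gal_wE perm1_54 perm1.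
have yi : val ((Phi (s ^+ 54)%g).2.1 i) != 0%N.
  apply/eqP => y0; apply: (neg_neq i); rewrite -w_i -(frob_expg frob); congr (phi _).
  by apply: val_inj; rewrite gal_w54 y0 val_w_int.
have yj : val ((Phi (s ^+ 54)%g).2.1 j) = 0%N.
  have gj := gal_w54 j; move: ((Phi (s ^+ 54)%g).2.1 j) gj => [[|[|m]] lt_m2] gj.
  - by [].
  - case: (neg_neq j); rewrite -[LHS]w_j -(frob_expg frob) -rmorphN; congr (phi _).
    apply: val_inj; rewrite gj [RHS](rmorphN (val : algint L -> L)).
    by rewrite [_ (w_int j)]val_w_int.
  - by [].
by exists i, j; apply: contraNneq yi => ->; rewrite yj.
Qed.

Section Image.
Variable H : {group cube_group}.
Hypothesis PhiH : forall s, Phi s \in H.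
Hypothesis HR : H \subset rubik.

(** s1 cycles the corners other than i0, s3 moves i0, and s2 gives a
    transposition. *)
Lemma onto_corners (r : {perm 'I_8}) : exists2 h, h \in H & h.1.2 = r.
Proof.
have gK : group_set [set h.1.2 | h : cube_group in H].
  apply/group_setP; split; first by apply/imsetP; exists 1%g; rewrite ?group1.
  move=> _ _ /imsetP[h Hh ->] /imsetP[g Hg ->]; apply/imsetP.
  by exists (h * g)%g; rewrite ?groupM.
have [s1 [s1_7 [i0 [s1_fix _]] _ _]] := frob233.
have [s2 [[a [b [ab s2E]]] _ _]] := frob439.
have [s3 [s3_fix _]] := frob97.
have inK s : (Phi s).1.2 \in group gK by apply/imsetP; exists (Phi s).
have tr := prime_cycle_transitive (isT : prime 7) (card_ord 8) s1_7 s1_fix.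
have Kab : tperm a b \in group gK by rewrite -s2E groupX.
have fix1 : (Phi s1).1.2 i0 = i0 by apply/eqP; rewrite s1_fix.
have := full_symmetric (inK s1) tr fix1 (inK s3) (s3_fix i0) Kab ab r.
by case/imsetP=> h Hh ->; exists h.
Qed.

Lemma onto_edges (r : {perm 'I_12}) : exists2 h, h \in H & h.2.2 = r.
Proof.
have gK : group_set [set h.2.2 | h : cube_group in H].
  apply/group_setP; split; first by apply/imsetP; exists 1%g; rewrite ?group1.
  move=> _ _ /imsetP[h Hh ->] /imsetP[g Hg ->]; apply/imsetP.
  by exists (h * g)%g; rewrite ?groupM.
have [s1 [_ _ s1_11 [i0 s1_fix]]] := frob233.
have [s2 [_ [a [b [ab s2E]]] _]] := frob439.
have [s3 [_ s3_fix]] := frob97.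
have inK s : (Phi s).2.2 \in group gK by apply/imsetP; exists (Phi s).
have tr := prime_cycle_transitive (isT : prime 11) (card_ord 12) s1_11 s1_fix.
have Kab : tperm a b \in group gK by rewrite -s2E groupX.
have fix1 : (Phi s1).2.2 i0 = i0 by apply/eqP; rewrite s1_fix.
have := full_symmetric (inK s1) tr fix1 (inK s3) (s3_fix i0) Kab ab r.
by case/imsetP=> h Hh ->; exists h.
Qed.

(** An edge permutation of order 11 has a nontrivial seventh power. *)
Lemma edges_only : exists h, [/\ h \in H, h.1.2 = 1%g & h.2.2 != 1%g].
Proof.
have [s1 [s1_7 _ s1_11 [i0 s1_fix]]] := frob233.
exists (Phi s1 ^+ 7)%g; rewrite groupX // expg_1_2 expg_2_2 s1_7; split=> //.
apply/eqP => s7.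
have s1_1 : (Phi s1).2.2 = 1%g.
  have : ((Phi s1).2.2 ^+ 22 = 1)%g by rewrite (expgM _ 11 2) s1_11 expg1n.
  by rewrite (expgS _ 21) (expgM _ 7 3) s7 expg1n mulg1.
have [j nj] : exists j, j != i0.
  exists (if i0 == ord0 then ord_max else ord0).
  by case: (eqVneq i0 ord0) => [->|] //; rewrite eq_sym.
by have := s1_fix j; rewrite s1_1 perm1 eqxx (negPf nj).
Qed.

(** The power 77 kills both permutations, and doubling then kills the edge
    flips.  The twist at the fixed corner i0 becomes 154 times x, and
    154 = 1 modulo 3.  The twists are not all equal: their sum is 0, while 8 times
    a nonzero element of Z/3 is not. *)
Lemma corner_twist : exists v i j, ((translation v, 1%g) : cube_group) \in H /\ v i != v j.
Proof.
have [s1 [s1_7 [i0 [s1_fix x0]] s1_11 _]] := frob233.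
pose c := (Phi s1 ^+ 77)%g.
have c1 : c.1.2 = 1%g by rewrite expg_1_2 (expgM _ 7 11) s1_7 expg1n.
have c2 : c.2.2 = 1%g by rewrite expg_2_2 (expgM _ 11 7) s1_11 expg1n.
pose v := c.1.1 *+ 2.
have cE : (c ^+ 2)%g = (translation v, 1%g).
  rewrite expg_pair; congr (_, _); first exact: wreath_expg_translation.
  by rewrite (wreath_expg_translation 2 c2) flip_double translation0.
have Hv : ((translation v, 1%g) : cube_group) \in H by rewrite -cE !groupX.
have v0 : v i0 != 0.
  rewrite ffunMnE /c expg_pair wreath_expg_fixed; last by apply/eqP; rewrite s1_fix.
  by case: ((Phi s1).1.1 i0) x0 => [[|[|[|]]] ?].
have : exists j, v i0 != v j.
  apply/existsP; apply: contraNT v0 => /existsPn v_const.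
  have := subsetP HR _ Hv; rewrite in_rubik => /and3P[/eqP sv _ _].
  have : v i0 *+ 8 = 0.
    rewrite -sv (eq_bigr (fun=> v i0)) ?sumr_const ?card_ord // => j _.
    by apply/esym/eqP; have := v_const j; rewrite negbK.
  by case: (v i0) => [[|[|[|]]] ?].
by case=> j vj; exists v, i0, j.
Qed.

(** 54 is an even multiple of 9, so the permutations disappear; the cube kills the
    corner twists and keeps the flips, 3 being odd. *)
Lemma edge_flip : exists v i j, ((1%g, translation v) : cube_group) \in H /\ v i != v j.
Proof.
have [s2 [[a [b [_ rE]]] [a' [b' [_ sE]]] [i [j yij]]]] := frob439.
pose c := Phi (s2 ^+ 54)%g.
have c1 : c.1.2 = 1%g.
  by rewrite /c Phi_expg expg_1_2 (expgM _ 9 6) rE (expgM _ 2 3) expg2 tperm2 expg1n.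
have c2 : c.2.2 = 1%g.
  by rewrite /c Phi_expg expg_2_2 (expgM _ 9 6) sE (expgM _ 2 3) expg2 tperm2 expg1n.
have cE : (c ^+ 3)%g = (1%g, translation c.2.1).
  rewrite expg_pair; congr (_, _).
    by rewrite (wreath_expg_translation 3 c1) twist_triple translation0.
  by rewrite (wreath_expg_translation 3 c2) mulrS flip_double addr0.
exists c.2.1, i, j; split; last exact: yij.
by rewrite -cE groupX ?PhiH.
Qed.

Lemma rubik_image : rubik \subset H.
Proof.
exact: rubik_criterion HR onto_corners onto_edges edges_only corner_twist edge_flip.
Qed.
End Image.
End Cube.

Local Open Scope group_scope.

(** Injectivity: an automorphism is determined by the roots of fg, which generate
    L. *)
Theorem theorem1 (L : splittingFieldType rat)
    (splitL : splitting_field_of (f_poly * g_poly)%R L) :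
  ('Gal({:L} / 1) \isog rubik)%g.
Proof.
case: splitL => rs fgE genL; rewrite rmorphM /= in fgE.
have f_dvd : (map_poly (in_alg L) f_poly %| \prod_(r <- rs) ('X - r%:P))%R.
  by rewrite -(eqp_dvdr _ fgE) dvdp_mulr.
have g_dvd : (map_poly (in_alg L) g_poly %| \prod_(r <- rs) ('X - r%:P))%R.
  by rewrite -(eqp_dvdr _ fgE) dvdp_mull.
have [xi [f_inj f_roots t_inj pE]] := f_cover f_dvd.
have [w [g_inj g_roots z_inj hE]] := g_cover g_dvd.
have [Phi [Phi8E Phi12E PhiM]] := cube_action f_inj f_roots g_inj g_roots.
have PhiM' : {in 'Gal({:L} / 1) &, {morph Phi : s s' / s * s'}} by move=> s s' _ _.
pose Psi := Morphism PhiM'.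
have gal_all (s : gal_of {:L}) : s \in 'Gal({:L} / 1).
  by rewrite gal_kHom ?sub1v // k1AHom.
have imR : Psi @* 'Gal({:L} / 1) \subset rubik.
  apply/subsetP => _ /morphimP[s _ _ ->].
  exact: (Phi_rubik f_roots t_inj pE z_inj hE Phi8E Phi12E).
have Psi_im s : Phi s \in (Psi @* 'Gal({:L} / 1))%G.
  by apply/morphimP; exists s.
have imE : Psi @* 'Gal({:L} / 1) = rubik.
  apply/eqP; rewrite eqEsubset imR /=.
  exact: (rubik_image f_roots pE hE Phi8E Phi12E PhiM Psi_im imR).
rewrite -imE; apply: sub_isog => //; apply/injmP => s s' _ _ eqPhi.
have agree_root r : r \in rs -> s r = s' r.
  move=> r_rs; have : root (map_poly (in_alg L) f_poly * map_poly (in_alg L) g_poly)%R r.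
    by rewrite (eqp_root fgE) root_prod_XsubC.
  rewrite rootM => /orP[/f_roots[[i e] ->]|/g_roots[[i e] rE]].
    by rewrite !Phi8E [Phi s]eqPhi.
  apply: (mulfI (den_neq0 L)); rewrite -[zr L _ in LHS](rmorph_zr s) -rmorphM /=.
  by rewrite -[zr L _ in RHS](rmorph_zr s') -rmorphM /= rE !Phi12E [Phi s]eqPhi.
pose u := s * s'^-1.
have u_fix : (<<1 & rs>> <= fixedField [set u])%VS.
  apply/Fadjoin_seqP; split; first exact: sub1v.
  move=> r r_rs; apply/fixedFieldP => [|_ /set1P ->]; first exact: memvf.
  by rewrite galM ?memvf // (agree_root r r_rs) -galM ?memvf // mulgV gal_id.
rewrite genL in u_fix; have u1 : u = 1.
  apply/eqP/gal_eqP => x _; rewrite gal_id.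
  have /fixedFieldP : x \in fixedField [set u] by apply: (subvP u_fix); apply: memvf.
  by move=> /(_ (memvf _) u (set11 _)).
by apply/eqP; rewrite eq_mulgV1 -/u u1.
Qed.
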